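(* Let $0<s_1\le r_1$, $0<s_2\le r_2$ and $f\in H_{mix}^{s_1,s_2}(\Omega_1\times\Omega_2)$. Choose $\sigma>0$ arbitrarily and set $$\beta:=\frac{n_1/\sigma+\sigma n_2}{n_1n_2}\min\{s_1/\sigma,s_2\sigma\}=\frac{1}{n_1n_2}\min\left\{\frac{s_1n_1}{\sigma^2}+s_1n_2,\ s_2n_1+s_2n_2\sigma^2\right\}.$$ Then, for every rank $R\in\mathbb{N}$ (with $R\ge2$ in the case $s_1/\sigma=s_2\sigma$), there exists a rank-$R$ approximation $$f_R(\boldsymbol{x}_1,\boldsymbol{x}_2)=\sum_{r=1}^R g_r^{(1)}(\boldsymbol{x}_1)\,g_r^{(2)}(\boldsymbol{x}_2)\in L^2(\Omega_1\times\Omega_2),\qquad g_r^{(i)}\in L^2(\Omega_i),$$ such that $$\|f-f_R\|_{L^2(\Omega_1\times\Omega_2)}\le\begin{cases}C\,R^{-\beta}\,\|f\|_{H_{mix}^{s_1,s_2}(\Omega_1\times\Omega_2)},&\text{if } s_1/\sigma\neq s_2\sigma,\\[2pt] C\,R^{-\beta}\sqrt{\log R}\,\|f\|_{H_{mix}^{s_1,s_2}(\Omega_1\times\Omega_2)},&\text{if } s_1/\sigma=s_2\sigma.\end{cases}$$ The constant $C$ depends on $s_1,s_2,n_1,n_2$ and $\sigma$ (and on the given domains and spaces), but not on the rank $R$ nor on $f$.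
   Context: Let $n_1,n_2\in\mathbb{N}$ and let $\Omega_i\subset\mathbb{R}^{n_i}$, $i=1,2$, be sufficiently smooth, bounded domains. For $s_1,s_2\ge0$, $H_{mix}^{s_1,s_2}(\Omega_1\times\Omega_2):=H^{s_1}(\Omega_1)\otimes H^{s_2}(\Omega_2)$ denotes the Hilbert space tensor product of the usual Sobolev spaces, equipped with the standard cross norm. For each $i=1,2$ there is given a nested sequence of finite dimensional subspaces $V_0^{(i)}\subset V_1^{(i)}\subset\cdots\subset L^2(\Omega_i)$ of piecewise polynomial functions with $\dim V_j^{(i)}\sim2^{jn_i}$, dense union in $L^2(\Omega_i)$, and polynomial exactness $r_i\in\mathbb{N}$ (the maximal order of polynomials locally contained in $V_j^{(i)}$), such that the approximation property $$\inf_{v_j\in V_j^{(i)}}\|u-v_j\|_{L^2(\Omega_i)}\lesssim 2^{-js}\|u\|_{H^s(\Omega_i)},\quad u\in H^s(\Omega_i),\ 0\le s\le r_i,$$ holds uniformly in $j$. Complement spaces $W_j^{(i)}$ with $V_j^{(i)}=V_{j-1}^{(i)}\oplus W_j^{(i)}$, $W_0^{(i)}:=V_0^{(i)}$, are spanned by wavelets $\psi_{j,k}^{(i)}$, $k\in\nabla_j^{(i)}$, whose collection over all $j\ge0$ is a Riesz basis of $L^2(\Omega_i)$ with biorthogonal dual basis $\widetilde\psi_{j,k}^{(i)}$. The projections $Q_j^{(i)}u:=\sum_{k\in\nabla_j^{(i)}}(u,\widetilde\psi_{j,k}^{(i)})_{L^2(\Omega_i)}\psi_{j,k}^{(i)}$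 onto $W_j^{(i)}$ satisfy $\|Q_j^{(i)}u\|_{L^2(\Omega_i)}\lesssim2^{-js}\|u\|_{H^s(\Omega_i)}$ for $0\le s\le r_i$, uniformly in $j$. *)

(* Defs.v *)
From HB Require Import structures.
From mathcomp Require Import all_boot all_order all_algebra.
From mathcomp Require Import all_classical all_reals all_analysis.

Set Implicit Arguments.
Unset Strict Implicit.
Unset Printing Implicit Defensive.

Import Order.TTheory GRing.Theory Num.Theory.
Import numFieldNormedType.Exports.

Local Open Scope classical_set_scope.
Local Open Scope ring_scope.

Definition rV_display : measure_display -> measure_display.
Proof. exact. Qed.

Section measurable_rV.
Context {d} {T : measurableType d} (n : nat).

Let coord (i : 'I_n) (x : 'rV[T]_n) : T := x ord0 i.

Let rV_set0 : g_sigma_preimage coord set0.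
Proof. exact: sigma_algebra0. Qed.

Let rV_setC A : g_sigma_preimage coord A -> g_sigma_preimage coord (~` A).
Proof. exact: sigma_algebraC. Qed.

Let rV_bigcup (F : (set 'rV[T]_n)^nat) :
  (forall i, g_sigma_preimage coord (F i)) ->
  g_sigma_preimage coord (\bigcup_i (F i)).
Proof. exact: sigma_algebra_bigcup. Qed.

HB.instance Definition _ := @isMeasurable.Build (rV_display d)
  'rV[T]_n (g_sigma_preimage coord) rV_set0 rV_setC rV_bigcup.

Lemma measurable_coord (i : 'I_n) :
  measurable_fun [set: 'rV[T]_n] (fun x => x ord0 i).
Proof.
move=> _ Y mY; rewrite setTI; apply: sub_sigma_algebra => /=.
rewrite -bigcup_seq/=; exists i => /=; first by rewrite mem_index_enum.
by exists Y => //; rewrite setTI.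
Qed.

Lemma measurable_fun_rV d' (S : measurableType d') (f : S -> 'rV[T]_n) :
  (forall i, measurable_fun [set: S] (fun x => f x ord0 i)) ->
  measurable_fun [set: S] f.
Proof.
move=> mf _ A mA; rewrite setTI.
pose F : set (set 'rV[T]_n) := [set B | measurable (f @^-1` B)].
suff : F A by [].
apply: (smallest_sub _ _ mA); first split.
- by rewrite /F /= preimage_set0; exact: measurable0.
- by move=> B FB; rewrite /F /= setTD preimage_setC; exact: measurableC.
- move=> B FB; rewrite /F /= preimage_bigcup.
  by apply: bigcup_measurable => k _; exact: FB.
- rewrite -bigcup_seq => B [i /= _] [Y mY] <-; rewrite setTI /F /=.
  by have := mf i measurableT Y mY; rewrite setTI.
Qed.

End measurable_rV.

Definition rV_cons (T : Type) (n : nat) (p : T * 'rV[T]_n) : 'rV[T]_n.+1 :=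
  \row_(i < n.+1) oapp (p.2 ord0) p.1 (unlift ord0 i).

Definition rV_uncons (T : Type) (n : nat) (x : 'rV[T]_n.+1) : T * 'rV[T]_n :=
  (x ord0 ord0, \row_(i < n) x ord0 (lift ord0 i)).

Section lebesgue_succ.
Context (R : realType) (n : nat).

Lemma rV_consK : cancel (@rV_cons R n) (@rV_uncons R n).
Proof.
move=> [a x]; rewrite /rV_uncons /rV_cons; congr pair.
  by rewrite mxE unlift_none.
by apply/rowP => i; rewrite !mxE liftK.
Qed.

Lemma measurable_rV_cons : measurable_fun [set: R * 'rV[R]_n] (@rV_cons R n).
Proof.
apply: measurable_fun_rV => i.
case: (unliftP ord0 i) => [j|] ->.
- rewrite (_ : (fun _ => _) = (fun y : 'rV[R]_n => y ord0 j) \o snd).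
    by apply: measurableT_comp; [exact: measurable_coord|].
  by apply/funext => -[a x]; rewrite /= mxE liftK.
- rewrite (_ : (fun _ => _) = fst)//.
  by apply/funext => -[a x]; rewrite /= mxE unlift_none.
Qed.

Lemma measurable_rV_uncons : measurable_fun [set: 'rV[R]_n.+1] (@rV_uncons R n).
Proof.
apply/measurable_fun_pairP; split => /=.
  exact: measurable_coord.
apply: measurable_fun_rV => i /=.
rewrite (_ : (fun _ => _) = (fun y : 'rV[R]_n.+1 => y ord0 (lift ord0 i))).
  exact: measurable_coord.
by apply/funext => x /=; rewrite mxE.
Qed.

Variable mu : {sigma_finite_measure set 'rV[R]_n -> \bar R}.

Definition lebesgue_succ : set 'rV[R]_n.+1 -> \bar R :=
  pushforward (@lebesgue_measure R \x mu)%E (@rV_cons R n).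

Let measurable_pre (A : set 'rV[R]_n.+1) :
  measurable A -> measurable (@rV_cons R n @^-1` A).
Proof.
by move=> mA; rewrite -[X in measurable X]setTI; exact: measurable_rV_cons.
Qed.

Let lebesgue_succ0 : lebesgue_succ set0 = 0%E.
Proof. by rewrite /lebesgue_succ /pushforward preimage_set0 measure0. Qed.

Let lebesgue_succ_ge0 A : (0 <= lebesgue_succ A)%E.
Proof. by rewrite /lebesgue_succ /pushforward; exact: measure_ge0. Qed.

Let lebesgue_succ_sigma_additive : semi_sigma_additive lebesgue_succ.
Proof.
move=> F mF tF mUF; rewrite /lebesgue_succ /pushforward preimage_bigcup.
apply: measure_semi_sigma_additive.
- by move=> k; exact: measurable_pre.
- apply/trivIsetP => /= i j _ _ ij; rewrite -preimage_setI.
  by move/trivIsetP : tF => /(_ _ _ _ _ ij) ->//; rewrite preimage_set0.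
- by rewrite -preimage_bigcup; exact: measurable_pre.
Qed.

HB.instance Definition _ := isMeasure.Build _ _ _
  lebesgue_succ lebesgue_succ0 lebesgue_succ_ge0 lebesgue_succ_sigma_additive.

Let lebesgue_succ_sigma_finite : sigma_finite setT lebesgue_succ.
Proof.
have /sigma_finiteP[F [FT ndF Foo]] := sigma_finiteT (@lebesgue_measure R).
have /sigma_finiteP[G [GT ndG Goo]] := sigma_finiteT mu.
exists (fun k => @rV_uncons R n @^-1` (F k `*` G k)).
  apply/esym; rewrite -subTset => x _.
  have [i _ Fi] : (\bigcup_i F i) (rV_uncons x).1 by rewrite -FT.
  have [j _ Gj] : (\bigcup_i G i) (rV_uncons x).2 by rewrite -GT.
  exists (maxn i j) => //; split.
    by move: Fi; exact/subsetPset/ndF/leq_maxl.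
  by move: Gj; exact/subsetPset/ndG/leq_maxr.
move=> k; have [mF Fk] := Foo k; have [mG Gk] := Goo k; split.
  rewrite -[X in measurable X]setTI.
  by apply: measurable_rV_uncons => //; exact: measurableX.
rewrite /lebesgue_succ /pushforward (_ : _ @^-1` _ = F k `*` G k).
  by rewrite product_measure1E// lte_mul_pinfty// ge0_fin_numE.
by apply/seteqP; split => x; rewrite /preimage /mkset rV_consK.
Qed.

HB.instance Definition _ := Measure_isSigmaFinite.Build _ _ _
  lebesgue_succ lebesgue_succ_sigma_finite.

End lebesgue_succ.

Fixpoint lebesgue_rV (R : realType) (n : nat) :
    {sigma_finite_measure set 'rV[R]_n -> \bar R} :=
  match n with
  | 0 => \d_ (0 : 'rV[R]_0)
  | m.+1 => @lebesgue_succ R m (lebesgue_rV R m)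
  end.

Lemma lebesgue_rV_box (R : realType) (n : nat) (a b : 'rV[R]_n) :
  (forall i, a ord0 i <= b ord0 i) ->
  lebesgue_rV R n [set x : 'rV[R]_n | forall i, a ord0 i <= x ord0 i <= b ord0 i] =
  (\prod_(i < n) (b ord0 i - a ord0 i))%:E.
Proof.
elim: n a b => [|n IHn] a b ab.
  rewrite big_ord0 /= diracE mem_set//= => -[//].
rewrite big_ord_recl EFinM.
pose tl (x : 'rV[R]_n.+1) := (rV_uncons x).2.
have tlE x i : tl x ord0 i = x ord0 (lift ord0 i) by rewrite mxE.
have E : @rV_cons R n @^-1`
      [set x : 'rV[R]_n.+1 | forall i, a ord0 i <= x ord0 i <= b ord0 i] =
    `[a ord0 ord0, b ord0 ord0]%classic `*`
      [set x : 'rV[R]_n | forall i, tl a ord0 i <= x ord0 i <= tl b ord0 i].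
  apply/seteqP; split => -[x y] /= h.
    split; first by have := h ord0; rewrite in_itv/= mxE unlift_none.
    by move=> i; have := h (lift ord0 i); rewrite mxE liftK/= !tlE.
  case: h => + h i; rewrite in_itv/= mxE.
  by case: (unliftP ord0 i) => [j|] ->//= _; have := h j; rewrite !tlE.
transitivity ((lebesgue_measure \x lebesgue_rV R n)%E
    (`[a ord0 ord0, b ord0 ord0]%classic `*`
      [set x : 'rV[R]_n | forall i, tl a ord0 i <= x ord0 i <= tl b ord0 i])).
  by rewrite -E.
rewrite product_measure1E//; last first.
  rewrite (_ : [set _ | _] = \bigcap_(i in [set: 'I_n])
    ((fun x : 'rV[R]_n => x ord0 i) @^-1`
       `[tl a ord0 i, tl b ord0 i]%classic)).
    apply: fin_bigcap_measurable => // i _.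
    rewrite -[X in measurable X]setTI.
    by apply: measurable_coord => //; exact: measurable_itv.
  apply/seteqP; split => x /= h i; first by move=> _; rewrite /= in_itv/=.
  by have := h i I; rewrite /= in_itv/=.
rewrite IHn; last by move=> i; rewrite !tlE.
rewrite [X in (X * _)%E]lebesgue_measure_itv/= lte_fin; congr (_ * _%:E)%E.
  have [_|ba] := ltP; first by rewrite -EFinB.
  have -> : b ord0 ord0 = a ord0 ord0 by apply/le_anti; rewrite ba ab.
  by rewrite subrr.
by apply: eq_bigr => i _; rewrite !tlE.
Qed.

Section L2.
Context d (T : measurableType d) (R : realType).
Variables (mu : {measure set T -> \bar R}) (D : set T).

Definition L2 : set (T -> R) := [set f | f \_ D \in Lfun mu 2%:E].

Definition l2inner (f g : T -> R) : R := \int[mu]_(x in D) (f x * g x).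

Definition l2norm (f : T -> R) : R := Num.sqrt (l2inner f f).

(** Linear span of a finite family, as a set of representatives: membership
    only depends on the class modulo equality a.e. on [D]. *)
Definition L2span (I : finType) (b : I -> T -> R) : set (T -> R) :=
  [set v | L2 v /\ exists c : I -> R,
     v = (fun x => \sum_i c i * b i x) %[ae mu in D]].

Definition L2free (I : finType) (b : I -> T -> R) : Prop :=
  forall c : I -> R,
    (fun x => \sum_i c i * b i x) = cst 0 %[ae mu in D] -> forall i, c i = 0.

Definition L2subspace_of_dim (V : set (T -> R)) (N : nat) : Prop :=
  exists b : 'I_N -> T -> R,
    [/\ (forall i, L2 (b i)), L2free b & V = L2span b].

End L2.

Section geometry.
Context (R : realType) (n : nat).
Implicit Types (x y e : 'rV[R]_n) (Omega : set 'rV[R]_n).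

Definition dotrV x y : R := \sum_(i < n) x ord0 i * y ord0 i.

(** The library norm of ['rV[R]_n] is the maximum norm. *)
Definition enorm x : R := Num.sqrt (dotrV x x).

(** Near each boundary point, [Omega] is the epigraph, in some direction [e],
    of a Lipschitz function of the coordinates orthogonal to [e]. *)
Definition lipschitz_boundary Omega : Prop :=
  forall x, (closure Omega `\` interior Omega) x ->
  exists (e : 'rV[R]_n) (rho L : R) (gamma : 'rV[R]_n -> R),
    [/\ enorm e = 1, 0 < rho,
        (forall y z, `|gamma y - gamma z| <= L * enorm (y - z)),
        (forall y (t : R), gamma (y + t *: e) = gamma y) &
        forall y, enorm (y - x) < rho -> (Omega y <-> gamma y < dotrV y e)].

Definition regular_domain Omega : Prop :=
  [/\ Omega !=set0, open Omega, connected Omega, bounded_set Omega &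
      lipschitz_boundary Omega].

(** Polynomials of order [m], i.e. of total degree [< m]. *)
Definition polynomial_of_order (m : nat) : set ('rV[R]_n -> R) :=
  [set p | exists c : {ffun 'I_n -> 'I_m} -> R,
     p = fun x => \sum_(a : {ffun 'I_n -> 'I_m} | (\sum_i a i < m)%N)
                    c a * \prod_i x ord0 i ^+ a i].

End geometry.

Section sobolev.
Context (R : realType) (n : nat).
Implicit Types (Omega : set 'rV[R]_n) (phi : 'rV[R]_n -> R) (s : R).

Definition partial (i : 'I_n) phi : 'rV[R]_n -> R :=
  fun x => 'D_(delta_mx ord0 i) phi x.

Definition smooth phi : Prop :=
  forall l : seq 'I_n, let psi := foldr partial phi l in
    continuous psi /\
    forall (i : 'I_n) x, derivable psi x (delta_mx ord0 i).

Definition test_function Omega phi : Prop :=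
  smooth phi /\
  exists K, [/\ compact K, K `<=` Omega & forall x, ~ K x -> phi x = 0].

Definition multiindex (k : nat) := {ffun 'I_n -> 'I_k.+1}.

Definition mi_order (k : nat) (a : multiindex k) : nat := \sum_i a i.

Definition mderive (k : nat) (a : multiindex k) phi : 'rV[R]_n -> R :=
  foldr (fun i => iter (a i) (partial i)) phi (enum 'I_n).

Definition weak_derivative Omega (k : nat) (a : multiindex k)
    (u g : 'rV[R]_n -> R) : Prop :=
  forall phi, test_function Omega phi ->
    l2inner (lebesgue_rV R n) Omega u (mderive a phi) =
    (-1) ^+ mi_order a * l2inner (lebesgue_rV R n) Omega g phi.

Definition int_part s : nat := Num.truncn s.
Definition frac_part s : R := s - (int_part s)%:R.

(** The L^2(Omega x Omega) inner product of these difference quotients is the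
    Slobodeckij form of order [theta]. *)
Definition slobodeckij_quotient (theta : R) (g : 'rV[R]_n -> R)
    (p : 'rV[R]_n * 'rV[R]_n) : R :=
  (g p.1 - g p.2) / enorm (p.1 - p.2) `^ (n%:R / 2 + theta).

(** An element of H^s(Omega) is bundled with its weak derivatives of order at
    most [int_part s], which it determines a.e.; the components of [sob_der]
    of larger order are irrelevant. *)
Record sobolev Omega s := Sobolev {
  sob_der : multiindex (int_part s) -> 'rV[R]_n -> R;
  sob_der_L2 : forall a, (mi_order a <= int_part s)%N ->
    L2 (lebesgue_rV R n) Omega (sob_der a);
  sob_der_weak : forall a, (mi_order a <= int_part s)%N ->
    weak_derivative Omega a (sob_der [ffun=> ord0]) (sob_der a);
  sob_der_slobodeckij : frac_part s != 0 ->
    forall a, mi_order a = int_part s ->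
    L2 (lebesgue_rV R n \x lebesgue_rV R n)%E (Omega `*` Omega)
      (slobodeckij_quotient (frac_part s) (sob_der a)) }.

Definition sob_fun Omega s (u : sobolev Omega s) : 'rV[R]_n -> R :=
  sob_der u [ffun=> ord0].

Coercion sob_fun : sobolev >-> Funclass.

Definition sob_inner Omega s (u v : sobolev Omega s) : R :=
  \sum_(a : multiindex (int_part s) | (mi_order a <= int_part s)%N)
     l2inner (lebesgue_rV R n) Omega (sob_der u a) (sob_der v a) +
  (if frac_part s == 0 then 0 else
   \sum_(a : multiindex (int_part s) | mi_order a == int_part s)
      l2inner (lebesgue_rV R n \x lebesgue_rV R n)%E (Omega `*` Omega)
        (slobodeckij_quotient (frac_part s) (sob_der u a))
        (slobodeckij_quotient (frac_part s) (sob_der v a))).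

Definition sob_norm Omega s (u : sobolev Omega s) : R :=
  Num.sqrt (sob_inner u u).

End sobolev.

Section hmix.
Context (R : realType) (n1 n2 : nat).
Variables (Omega1 : set 'rV[R]_n1) (Omega2 : set 'rV[R]_n2) (s1 s2 : R).

(** The list [[:: (u_1, v_1), (u_2, v_2), ...]] stands for the element
    $\sum_i u_i \otimes v_i$ of the algebraic tensor product. *)
Definition tensor := seq (sobolev Omega1 s1 * sobolev Omega2 s2).

Definition tensor_fun (F : tensor) (x : 'rV[R]_n1 * 'rV[R]_n2) : R :=
  \sum_(p <- F) p.1 x.1 * p.2 x.2.

Definition tensor_inner (F G : tensor) : R :=
  \sum_(p <- F) \sum_(q <- G) sob_inner p.1 q.1 * sob_inner p.2 q.2.

Definition tensor_norm (F : tensor) : R := Num.sqrt (tensor_inner F F).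

(** Norm of the difference of two tensors. *)
Definition tensor_dist (F G : tensor) : R :=
  Num.sqrt (tensor_inner F F - 2 * tensor_inner F G + tensor_inner G G).

(** The completion of the algebraic tensor product, realized inside
    L^2(Omega1 x Omega2), into which it embeds continuously: an element is the
    L^2-limit of a sequence that is Cauchy for the cross norm. *)
Record hmix := Hmix {
  hmix_fun :> 'rV[R]_n1 * 'rV[R]_n2 -> R;
  hmix_seq : nat -> tensor;
  hmix_L2 :
    L2 (lebesgue_rV R n1 \x lebesgue_rV R n2)%E (Omega1 `*` Omega2) hmix_fun;
  hmix_cauchy : forall eps : R, 0 < eps -> exists N : nat,
    forall k l : nat, (N <= k)%N -> (N <= l)%N ->
      tensor_dist (hmix_seq k) (hmix_seq l) < eps;
  hmix_cvg :
    (fun k => l2norm (lebesgue_rV R n1 \x lebesgue_rV R n2)%E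
       (Omega1 `*` Omega2) (fun x => hmix_fun x - tensor_fun (hmix_seq k) x))
    @ \oo --> (0 : R) }.

Definition hmix_norm (f : hmix) : R :=
  lim ((fun k => tensor_norm (hmix_seq f k)) @ \oo).

End hmix.

Section multiscale.
Context (R : realType) (n : nat).
Variables (Omega : set 'rV[R]_n).
Local Notation mu := (lebesgue_rV R n).

(** A finite partition of [Omega], up to a null set, into open cells. *)
Definition mesh (m : nat) (cell : 'I_m -> set 'rV[R]_n) : Prop :=
  [/\ forall i, [/\ open (cell i), cell i !=set0 & cell i `<=` Omega],
      forall i j, i != j -> cell i `&` cell j = set0 &
      mu.-negligible (Omega `\` \bigcup_i cell i)].

Definition piecewise_polynomial (m : nat) (cell : 'I_m -> set 'rV[R]_n)
    (v : 'rV[R]_n -> R) : Prop :=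
  forall i, exists k p, polynomial_of_order k p /\ v = p %[ae mu in cell i].

Definition contains_polynomials (m : nat) (cell : 'I_m -> set 'rV[R]_n)
    (V : set ('rV[R]_n -> R)) (k : nat) : Prop :=
  forall i p, polynomial_of_order k p ->
    exists2 v, V v & v = p %[ae mu in cell i].

Definition L2dense (D : set ('rV[R]_n -> R)) : Prop :=
  forall u, L2 mu Omega u -> forall eps : R, 0 < eps ->
    exists2 v, D v & l2norm mu Omega (u - v) < eps.

Variables (nabla : nat -> finType).

Definition synthesis (psi : forall j, nabla j -> 'rV[R]_n -> R) (J : nat)
    (c : forall j, nabla j -> R) : 'rV[R]_n -> R :=
  fun x => \sum_(j < J) \sum_(k : nabla j) c j k * psi j k x.

Definition riesz_basis (psi : forall j, nabla j -> 'rV[R]_n -> R) : Prop :=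
  [/\ forall j k, L2 mu Omega (psi j k),
      L2dense [set v | exists J c, v = synthesis psi J c] &
      exists A B : R, [/\ 0 < A, 0 < B & forall (J : nat) (c : forall j, nabla j -> R),
        A * \sum_(j < J) \sum_(k : nabla j) c j k ^+ 2
          <= l2norm mu Omega (synthesis psi J c) ^+ 2
          <= B * \sum_(j < J) \sum_(k : nabla j) c j k ^+ 2]].

Definition wavelet_projection (psi dpsi : forall j, nabla j -> 'rV[R]_n -> R)
    (j : nat) (u : 'rV[R]_n -> R) : 'rV[R]_n -> R :=
  fun x => \sum_(k : nabla j) l2inner mu Omega u (dpsi j k) * psi j k x.

End multiscale.

Record multiscale (R : realType) (n : nat) (Omega : set 'rV[R]_n) (r : nat) :=
    Multiscale {
  ms_V : nat -> set ('rV[R]_n -> R);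
  ms_dim : nat -> nat;
  ms_ncell : nat -> nat;
  ms_cell : forall j, 'I_(ms_ncell j) -> set 'rV[R]_n;
  ms_nabla : nat -> finType;
  ms_psi : forall j, ms_nabla j -> 'rV[R]_n -> R;
  ms_dpsi : forall j, ms_nabla j -> 'rV[R]_n -> R;
  ms_V_dim : forall j,
    L2subspace_of_dim (lebesgue_rV R n) Omega (ms_V j) (ms_dim j);
  ms_dim_growth : exists a b : R, [/\ 0 < a, 0 < b & forall j,
    a * 2 ^+ (j * n) <= (ms_dim j)%:R <= b * 2 ^+ (j * n)];
  ms_V_nested : forall j, ms_V j `<=` ms_V j.+1;
  ms_V_dense : L2dense Omega (\bigcup_j ms_V j);
  ms_mesh : forall j, mesh Omega (@ms_cell j);
  ms_V_piecewise : forall j v, ms_V j v -> piecewise_polynomial (@ms_cell j) v;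
  ms_exactness : forall j,
    contains_polynomials (@ms_cell j) (ms_V j) r /\
    ~ contains_polynomials (@ms_cell j) (ms_V j) r.+1;
  ms_approximation : forall s : R, 0 <= s <= r%:R -> exists C : R,
    forall j (u : sobolev Omega s),
      inf [set l2norm (lebesgue_rV R n) Omega ((u : _ -> R) - v) | v in ms_V j]
        <= C * 2 `^ (- (j%:R * s)) * sob_norm u;
  ms_riesz : riesz_basis Omega ms_psi;
  ms_dual_L2 : forall j k, L2 (lebesgue_rV R n) Omega (@ms_dpsi j k);
  ms_biorthogonal : forall j (k : ms_nabla j) j' (k' : ms_nabla j'),
    l2inner (lebesgue_rV R n) Omega (ms_psi k) (ms_dpsi k') =
    (Tagged ms_nabla k == Tagged ms_nabla k')%:R;
  (* W_j is the span of the wavelets of level j *)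
  ms_W0 : ms_V 0 = L2span (lebesgue_rV R n) Omega (@ms_psi 0);
  ms_V_sum : forall j v, ms_V j.+1 v <->
    L2 (lebesgue_rV R n) Omega v /\
    exists u w, [/\ ms_V j u,
      L2span (lebesgue_rV R n) Omega (@ms_psi j.+1) w &
      v = u + w %[ae lebesgue_rV R n in Omega]];
  ms_V_direct : forall j v, ms_V j v ->
    L2span (lebesgue_rV R n) Omega (@ms_psi j.+1) v ->
    v = cst 0 %[ae lebesgue_rV R n in Omega];
  ms_projection : forall s : R, 0 <= s <= r%:R -> exists C : R,
    forall j (u : sobolev Omega s),
      l2norm (lebesgue_rV R n) Omega
        (wavelet_projection Omega ms_psi ms_dpsi j u)
        <= C * 2 `^ (- (j%:R * s)) * sob_norm u }.

Definition rate (R : realType) (n1 n2 : nat) (s1 s2 sigma : R) : R :=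
  (n1%:R / sigma + sigma * n2%:R) / (n1%:R * n2%:R) *
  Num.min (s1 / sigma) (s2 * sigma).

(* Main.v *)
Require Import Defs.
From mathcomp Require Import all_boot all_order all_algebra.
From mathcomp Require Import all_classical all_reals all_analysis measurable_realfun.
From mathcomp Require Import ring lra.

Set Implicit Arguments.
Unset Strict Implicit.
Unset Printing Implicit Defensive.

Import Order.TTheory GRing.Theory Num.Theory.
Import numFieldNormedType.Exports.

Local Open Scope classical_set_scope.
Local Open Scope ring_scope.

(** The approximation is the boolean sum of two orthogonal projections. Let [P1]
    and [P2] be the L^2-orthogonal projections onto the spaces [V_J1] and [V_J2] of
    the two scales. The operator [1 - (1 - P1) (x) (1 - P2)] has rank at most
    [dim V_J1 + dim V_J2], and its error [(1 - P1) (x) (1 - P2)] is of order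
    [2^(- J1 s1) * 2^(- J2 s2)] from the cross norm to L^2. With the finest levels
    satisfying [dim V_J <= N / 2] in each factor, the error is of order [N^(- a)]
    with [a = s1 / n1 + s2 / n2]. Dividing out,
    [beta = min (s1 / (n2 sigma^2) + s1 / n1) (s2 / n2 + s2 sigma^2 / n1)]; the
    first argument is at most [a] when [s1 <= s2 sigma^2], the second one when
    [s2 sigma^2 <= s1]. Hence [beta <= a] for every [sigma]; the bound without the
    logarithm implies the other one, since [sqrt (log N) >= sqrt (log 2)].

    The norm of a tensor product of two operators is handled by Schur's product
    theorem ([schur_l2inner], [schur_sob_inner], [tensor_operator_bound]): the
    squared norm of [\sum_p a_p (x) b_p] is the sum of the entrywise product of two
    Gram matrices, and replacing one of them by a larger one, for the order of
    positive semidefinite matrices, increases that sum. This needs the bound on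
    [1 - P] for all linear combinations of given Sobolev functions, hence the
    linear structure of the bundled Sobolev functions ([sobolev_lin]); weak
    derivatives are linear because test functions and their derivatives are in
    L^2 of a bounded open set, the topology of row vectors being measurable for
    the product sigma-algebra ([open_measurable_rV], [continuous_L2]).

    An element [f] of the completion is compared with an algebraic tensor [F] which
    is so close to [f] in L^2 that the approximant of [F] serves [f] as well
    ([hmix_approx]). *)

(** * Square-integrable functions on a subset *)

Section L2_theory.
Context d (T : measurableType d) (R : realType).
Variables (mu : {measure set T -> \bar R}) (D : set T).
Implicit Types f g h : T -> R.

Lemma patch_sum (I : Type) (r : seq I) (c : I -> R) (f : I -> T -> R) :
  (fun x => \sum_(i <- r) c i * f i x) \_ D =
  (fun x => \sum_(i <- r) c i * (f i \_ D) x).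
Proof.
apply/funext => x; rewrite patchE; case: ifPn => xD.
  by apply: eq_bigr => i _; rewrite patchE xD.
by rewrite big1// => i _; rewrite patchE (negbTE xD) mulr0.
Qed.

Lemma patch_mul f g : (fun x => f x * g x) \_ D = (f \_ D) \* (g \_ D).
Proof.
apply/funext => x; rewrite /= !patchE; case: ifPn => xD //.
by rewrite mulr0.
Qed.

Lemma Lfun2_sqr f : measurable_fun setT f ->
  mu.-integrable setT (EFin \o (fun x => f x ^+ 2)) -> f \in Lfun mu 2%:E.
Proof.
move=> mf /integrableP[_ fi]; rewrite inE; apply/andP; split; rewrite inE//=.
rewrite /finite_norm unlock poweR_lty//.
apply: le_lt_trans fi; apply: ge0_le_integral => //=.
- apply/measurable_EFinP.
  apply/(@measurableT_comp _ _ _ _ _ _ (fun x : R => x `^ 2)%R) => //.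
  exact/measurableT_comp.
- apply/measurable_EFinP; apply: measurableT_comp => //; exact: measurable_funX.
- by move=> x _; rewrite lee_fin normrX powR_mulrn.
Qed.

Lemma L2_measurable f : L2 mu D f -> measurable_fun setT (f \_ D).
Proof. by rewrite /L2/= inE => /andP[]; rewrite inE. Qed.

Lemma L2_sum (I : Type) (r : seq I) (c : I -> R) (f : I -> T -> R) :
  (forall i, L2 mu D (f i)) -> L2 mu D (fun x => \sum_(i <- r) c i * f i x).
Proof.
move=> fL; rewrite /L2 /= patch_sum.
have -> : (fun x => \sum_(i <- r) c i * (f i \_ D) x) =
  \sum_(i <- r) c i *: (f i \_ D : T -> R).
  by apply/funext => x; rewrite fct_sumE.
have p1 : (1 <= 2%:E :> \bar R)%E by rewrite lee_fin ler1n.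
have [p0 pD] := Lfun_submod_closed mu p1.
elim: r => [|i r IH]; first by rewrite big_nil.
by rewrite big_cons; apply: pD => //; exact: fL.
Qed.

Lemma L2_cst0 : L2 mu D (cst 0).
Proof.
have := @L2_sum 'I_0 [::] (fun=> 0) (fun=> cst 0) (fun i => _).
rewrite (_ : (fun x => _) = cst 0); first by apply; case.
by apply/funext => x; rewrite big_nil.
Qed.

Lemma L2_lin a b f g :
  L2 mu D f -> L2 mu D g -> L2 mu D (fun x => a * f x + b * g x).
Proof.
move=> fL gL.
have := @L2_sum bool [:: true; false] (fun e => if e then a else b)
  (fun e => if e then f else g).
rewrite (_ : (fun x => \sum_(i <- _) _) = (fun x => a * f x + b * g x)).
  by apply; case.
by apply/funext => x; rewrite !big_cons big_nil addr0.
Qed.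

Lemma L2B f g : L2 mu D f -> L2 mu D g -> L2 mu D (fun x => f x - g x).
Proof.
move=> fL gL; have -> : (fun x => f x - g x) = fun x => 1 * f x + -1 * g x.
  by apply/funext => x; rewrite mul1r mulN1r.
exact: L2_lin.
Qed.

Lemma L2_mul_integrable f g : L2 mu D f -> L2 mu D g ->
  mu.-integrable setT (EFin \o ((fun x => f x * g x) \_ D)).
Proof.
move=> fL gL; rewrite patch_mul; apply/Lfun1_integrable.
exact: Lfun2_mul_Lfun1.
Qed.

Lemma l2innerE f g :
  l2inner mu D f g = \int[mu]_x ((fun x => f x * g x) \_ D) x.
Proof. by rewrite /l2inner Rintegral_mkcond. Qed.

Lemma l2innerC f g : l2inner mu D f g = l2inner mu D g f.
Proof. by apply: eq_Rintegral => x _; rewrite mulrC. Qed.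

Lemma l2inner_ge0 f : 0 <= l2inner mu D f f.
Proof. by apply: Rintegral_ge0 => x _; rewrite -expr2 sqr_ge0. Qed.

(** Stated for weighted sums of products, so as to give both the bilinearity of
    the inner product and Schur's product theorem. *)
Lemma Rintegral_weighted_sum (I : Type) (r : seq I) (c : I -> R)
    (f g : I -> T -> R) :
  (forall i, L2 mu D (f i)) -> (forall i, L2 mu D (g i)) ->
  \int[mu]_(x in D) (\sum_(i <- r) c i * (f i x * g i x)) =
  \sum_(i <- r) c i * l2inner mu D (f i) (g i).
Proof.
move=> fL gL; rewrite Rintegral_mkcond patch_sum.
have fgi i := L2_mul_integrable (fL i) (gL i).
rewrite /Rintegral; under eq_integral do rewrite -sumEFin.
rewrite integral_sum//; last first.
  by move=> i; exact: integrableZl (c i) _ (fgi i).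
rewrite -[RHS]/(fine (\sum_(i <- r) c i * l2inner mu D (f i) (g i))%:E).
congr fine; rewrite -sumEFin; apply: eq_bigr => i _.
have := fgi i; set h := _ \_ D => hi; transitivity ((c i)%:E * \int[mu]_x (h x)%:E)%E.
  by rewrite -integralZl//; apply: eq_integral => x _; rewrite patch_mul.
rewrite EFinM l2innerE /Rintegral fineK//; exact: integrable_fin_num.
Qed.

Lemma l2inner_suml (I : Type) (r : seq I) (c : I -> R) (f : I -> T -> R) g :
  (forall i, L2 mu D (f i)) -> L2 mu D g ->
  l2inner mu D (fun x => \sum_(i <- r) c i * f i x) g =
  \sum_(i <- r) c i * l2inner mu D (f i) g.
Proof.
move=> fL gL; rewrite -(Rintegral_weighted_sum _ _ (g := fun=> g))//.
apply: eq_Rintegral => x _; rewrite mulr_suml.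
by apply: eq_bigr => i _; rewrite mulrA.
Qed.

Lemma l2inner_sum2 (I J : Type) (r : seq I) (s : seq J) (c : I -> R) (e : J -> R)
    (f : I -> T -> R) (g : J -> T -> R) :
  (forall i, L2 mu D (f i)) -> (forall j, L2 mu D (g j)) ->
  l2inner mu D (fun x => \sum_(i <- r) c i * f i x)
               (fun x => \sum_(j <- s) e j * g j x) =
  \sum_(i <- r) \sum_(j <- s) c i * e j * l2inner mu D (f i) (g j).
Proof.
move=> fL gL; rewrite l2inner_suml//; last exact: L2_sum.
apply: eq_bigr => i _; rewrite l2innerC l2inner_suml// mulr_sumr.
by apply: eq_bigr => j _; rewrite mulrA l2innerC.
Qed.

Lemma l2innerBl f g h : L2 mu D f -> L2 mu D g -> L2 mu D h ->
  l2inner mu D (fun x => f x - g x) h = l2inner mu D f h - l2inner mu D g h.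
Proof.
move=> fL gL hL.
pose c e : R := if e then 1 else (-1); pose k (e : bool) := if e then f else g.
have -> : (fun x => f x - g x) = fun x => \sum_(i <- [:: true; false]) c i * k i x.
  by apply/funext => x; rewrite !big_cons big_nil /= addr0 mul1r mulN1r.
rewrite l2inner_suml//; last by case.
by rewrite !big_cons big_nil /= addr0 mul1r mulN1r.
Qed.

Lemma l2inner_lin a b f g : L2 mu D f -> L2 mu D g ->
  l2inner mu D (fun x => a * f x + b * g x) (fun x => a * f x + b * g x) =
  a ^+ 2 * l2inner mu D f f + 2 * (a * b) * l2inner mu D f g +
  b ^+ 2 * l2inner mu D g g.
Proof.
move=> fL gL.
pose c e := if e then a else b; pose h (e : bool) := if e then f else g.
have hE : (fun x => a * f x + b * g x) =
    (fun x => \sum_(i <- [:: true; false]) c i * h i x).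
  by apply/funext => x; rewrite !big_cons big_nil addr0.
rewrite hE l2inner_sum2; [|by case|by case].
rewrite !big_cons !big_nil /= (l2innerC g f); ring.
Qed.

End L2_theory.

Definition psd (R : realType) (I : Type) (r : seq I) (M : I -> I -> R) :=
  forall w : I -> R, 0 <= \sum_(p <- r) \sum_(q <- r) w p * w q * M p q.

Section psd_theory.
Context d (T : measurableType d) (R : realType).
Variables (mu : {measure set T -> \bar R}) (D : set T).

(** Schur's product theorem against a Gram matrix: the sum is the integral over
    [x] of the quadratic form of [M] at the weights [f p x]. *)
Lemma schur_l2inner (I : Type) (r : seq I) (M : I -> I -> R) (f : I -> T -> R) :
  psd r M -> (forall i, L2 mu D (f i)) ->
  0 <= \sum_(p <- r) \sum_(q <- r) M p q * l2inner mu D (f p) (f q).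
Proof.
move=> M0 fL.
rewrite -(@big_allpairs _ _ _ _ _ r r
  (fun pq => M pq.1 pq.2 * l2inner mu D (f pq.1) (f pq.2))).
rewrite -(@Rintegral_weighted_sum _ _ _ mu D _ _ (fun pq => M pq.1 pq.2)
  (fun pq => f pq.1) (fun pq => f pq.2))//.
apply: Rintegral_ge0 => x _; rewrite big_allpairs /=.
have := M0 (f ^~ x); congr (0 <= _); apply: eq_bigr => p _.
by apply: eq_bigr => q _; rewrite mulrC.
Qed.

End psd_theory.

(** Cauchy-Schwarz for a form known only through its values on a plane. *)
Lemma cauchy_schwarz_plane (R : realType) (a b c : R) :
  0 <= a -> 0 <= c ->
  (forall x y : R, 0 <= x ^+ 2 * a + 2 * (x * y) * b + y ^+ 2 * c) ->
  b <= Num.sqrt a * Num.sqrt c.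
Proof.
move=> a0 c0 h.
suff : b ^+ 2 <= a * c.
  by rewrite -sqrtrM// => /ler_wsqrtr; rewrite sqrtr_sqr; apply/le_trans/ler_norm.
have [cE|c_neq0] := eqVneq c 0.
  (* at this point the form takes the value - b ^+ 2 *)
  have := h b (- (a + 1) / 2); rewrite cE.
  suff -> : b ^+ 2 * a + 2 * (b * (- (a + 1) / 2)) * b + (- (a + 1) / 2) ^+ 2 * 0 =
    - b ^+ 2 by rewrite oppr_ge0 mulr0.
  by field.
(* the minimum of the form on the line x = c *)
have := h c (- b).
have -> : c ^+ 2 * a + 2 * (c * - b) * b + (- b) ^+ 2 * c = c * (a * c - b ^+ 2).
  by ring.
by rewrite pmulr_rge0 ?subr_ge0// lt_def c_neq0.
Qed.

Section L2_norm.
Context d (T : measurableType d) (R : realType).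
Variables (mu : {measure set T -> \bar R}) (D : set T).
Implicit Types f g h : T -> R.

Lemma l2norm_ge0 f : 0 <= l2norm mu D f. Proof. exact: sqrtr_ge0. Qed.

Lemma l2norm_sqr f : l2norm mu D f ^+ 2 = l2inner mu D f f.
Proof. by rewrite sqr_sqrtr// l2inner_ge0. Qed.

Lemma l2norm_le f (c : R) : 0 <= c -> l2inner mu D f f <= c ^+ 2 ->
  l2norm mu D f <= c.
Proof.
by move=> c0 h; rewrite -(ler_pXn2r (n := 2))// ?nnegrE ?l2norm_ge0// l2norm_sqr.
Qed.

Lemma l2norm_triangle f g h : L2 mu D (fun x => f x - g x) ->
  L2 mu D (fun x => g x - h x) ->
  l2norm mu D (fun x => f x - h x) <=
  l2norm mu D (fun x => f x - g x) + l2norm mu D (fun x => g x - h x).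
Proof.
set u := fun x => f x - g x; set v := fun x => g x - h x => uL vL.
have -> : (fun x => f x - h x) = (fun x => 1 * u x + 1 * v x).
  by apply/funext => x; rewrite /u /v; ring.
apply: l2norm_le; first by rewrite addr_ge0 ?l2norm_ge0.
rewrite l2inner_lin// sqrrD !l2norm_sqr expr1n !mul1r !mulr1.
suff : l2inner mu D u v <= l2norm mu D u * l2norm mu D v by lra.
apply: cauchy_schwarz_plane; rewrite ?l2inner_ge0// => x y.
by rewrite -l2inner_lin// l2inner_ge0.
Qed.

End L2_norm.

(** * Products of square-integrable functions *)

Section L2_product.
Context d1 d2 (T1 : measurableType d1) (T2 : measurableType d2) (R : realType).
Variables (mu1 : {sigma_finite_measure set T1 -> \bar R})
          (mu2 : {sigma_finite_measure set T2 -> \bar R}).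
Variables (D1 : set T1) (D2 : set T2).

Lemma integrable_prod (u : T1 -> R) (v : T2 -> R) :
  mu1.-integrable setT (EFin \o u) -> mu2.-integrable setT (EFin \o v) ->
  (mu1 \x mu2)%E.-integrable setT (EFin \o (fun z => u z.1 * v z.2)).
Proof.
move=> /[dup] ui /integrableP[mu ufin] /[dup] vi /integrableP[mv vfin].
have {}mu : measurable_fun setT u by exact/measurable_EFinP.
have {}mv : measurable_fun setT v by exact/measurable_EFinP.
apply/integrable12ltyP.
  apply/measurable_EFinP/measurable_funM.
  - by apply: measurableT_comp.
  - by apply: measurableT_comp.
have vE x : (\int[mu2]_y `|(EFin \o (fun z => u z.1 * v z.2)%R) (x, y)| =
     `|(u x)%:E| * \int[mu2]_y `|(v y)%:E|)%E.
  rewrite -ge0_integralZl//.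
  - by apply: eq_integral => y _; rewrite /= normrM EFinM.
  - by apply/measurable_EFinP; exact: measurableT_comp.
under eq_integral do rewrite vE.
rewrite ge0_integralZr//; last 2 first.
- by apply/measurable_EFinP; exact: measurableT_comp.
- exact: integral_ge0.
by apply: lte_mul_pinfty => //; [exact: integral_ge0|rewrite ge0_fin_numE// integral_ge0].
Qed.

Lemma Rintegral_prod (u : T1 -> R) (v : T2 -> R) :
  mu1.-integrable setT (EFin \o u) -> mu2.-integrable setT (EFin \o v) ->
  \int[(mu1 \x mu2)%E]_z (u z.1 * v z.2) = (\int[mu1]_x u x) * (\int[mu2]_y v y).
Proof.
move=> ui vi.
rewrite /Rintegral -(integral12_prod_meas1 (integrable_prod ui vi)) /fubini_F.
have vE x : (\int[mu2]_y (EFin \o (fun z => u z.1 * v z.2)%R) (x, y) =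
     (u x)%:E * (fine (\int[mu2]_y (v y)%:E))%:E)%E.
  rewrite fineK; last exact: integrable_fin_num.
  by rewrite -integralZl//; apply: eq_integral => y _; rewrite /= EFinM.
transitivity (fine (\int[mu1]_x ((u x)%:E * (fine (\int[mu2]_y (v y)%:E))%:E)%E)).
  by congr fine; apply: eq_integral => x _; exact: vE.
rewrite integralZr// fineM//; exact: integrable_fin_num.
Qed.

Lemma patch_prod (u : T1 -> R) (v : T2 -> R) :
  (fun z => u z.1 * v z.2) \_ (D1 `*` D2) =
  (fun z => (u \_ D1) z.1 * (v \_ D2) z.2).
Proof.
apply/funext => z; rewrite !patchE in_setX.
by case: (_ \in D1); case: (_ \in D2); rewrite /= ?mulr0 ?mul0r.
Qed.

Lemma L2_prod (u : T1 -> R) (v : T2 -> R) : L2 mu1 D1 u -> L2 mu2 D2 v ->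
  L2 (mu1 \x mu2)%E (D1 `*` D2) (fun z => u z.1 * v z.2).
Proof.
move=> uL vL; rewrite /L2/= patch_prod; apply: Lfun2_sqr.
  apply: measurable_funM.
  - by apply: measurableT_comp => //; exact: L2_measurable uL.
  - by apply: measurableT_comp => //; exact: L2_measurable vL.
under eq_fun do rewrite exprMn.
by apply: (@integrable_prod (fun x => (u \_ D1) x ^+ 2)
  (fun y => (v \_ D2) y ^+ 2)); exact: Lfun2_integrable_sqr.
Qed.

Lemma l2inner_prod (u u' : T1 -> R) (v v' : T2 -> R) :
  L2 mu1 D1 u -> L2 mu1 D1 u' -> L2 mu2 D2 v -> L2 mu2 D2 v' ->
  l2inner (mu1 \x mu2)%E (D1 `*` D2) (fun z => u z.1 * v z.2)
    (fun z => u' z.1 * v' z.2) = l2inner mu1 D1 u u' * l2inner mu2 D2 v v'.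
Proof.
move=> uL uL' vL vL'; rewrite !l2innerE -Rintegral_prod; last 2 first.
- exact: L2_mul_integrable.
- exact: L2_mul_integrable.
rewrite -(patch_prod (fun x => u x * u' x) (fun y => v y * v' y)).
by congr (Rintegral _ _ (_ \_ _)); apply/funext => z /=; rewrite mulrACA.
Qed.

(** The Gram matrix of a family of elementary tensors is the entrywise product
    of the two Gram matrices. *)
Lemma l2inner_tensor (I : Type) (r : seq I) (a : I -> T1 -> R) (b : I -> T2 -> R) :
  (forall i, L2 mu1 D1 (a i)) -> (forall i, L2 mu2 D2 (b i)) ->
  let F := fun z => \sum_(i <- r) a i z.1 * b i z.2 in
  L2 (mu1 \x mu2)%E (D1 `*` D2) F /\
  l2inner (mu1 \x mu2)%E (D1 `*` D2) F F =
  \sum_(p <- r) \sum_(q <- r) l2inner mu1 D1 (a p) (a q) * l2inner mu2 D2 (b p) (b q).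
Proof.
move=> aL bL F.
have abL i := L2_prod (aL i) (bL i).
have -> : F = fun z => \sum_(i <- r) (fun=> 1) i * (a i z.1 * b i z.2).
  by apply/funext => z; apply: eq_bigr => i _; rewrite mul1r.
split; first exact: (L2_sum _ _ abL).
rewrite (@l2inner_sum2 _ _ _ _ _ _ _ _ _ _ _ _ _ abL abL).
apply: eq_bigr => p _; apply: eq_bigr => q _.
by rewrite !mul1r l2inner_prod.
Qed.

End L2_product.

(** * Continuous functions on bounded open sets *)

Section borel_rV.
Context (R : realType) (n : nat).
Implicit Types (Omega U : set 'rV[R]_n) (phi : 'rV[R]_n -> R).

Lemma measurable_box (F : 'I_n -> set R) : (forall i, measurable (F i)) ->
  measurable [set x : 'rV[R]_n | forall i, F i (x ord0 i)].
Proof.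
move=> mF.
rewrite (_ : [set x | _] =
    \bigcap_(i in [set: 'I_n]) ((fun x : 'rV[R]_n => x ord0 i) @^-1` F i)).
  apply: fin_bigcap_measurable => // i _; rewrite -[X in measurable X]setTI.
  exact: measurable_coord.
by apply/seteqP; split => x /= h i; [move=> _; exact: h|exact: (h i I)].
Qed.

Let dist_split (x y q z e : R) : `|q - x| < z -> `|y - q| < z -> z < e / 2 ->
  `|x - y| < e.
Proof.
rewrite !ltr_distl => /andP[x1 x2] /andP[y1 y2] ze.
by apply/andP; split; lra.
Qed.

(** The sigma-algebra generated by the coordinates contains the topology: an
    open set is the union of the rational cubes that it contains. *)
Lemma open_measurable_rV U : open U -> measurable U.
Proof.
move=> oU.
pose box (p : 'rV[rat]_n * nat) : set 'rV[R]_n :=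
  [set x | forall i,
     `]ratr (p.1 ord0 i) - p.2.+1%:R^-1, ratr (p.1 ord0 i) + p.2.+1%:R^-1[%classic
       (x ord0 i)].
pose F p := if `[< box p `<=` U >] then box p else set0.
have -> : U = \bigcup_p F p.
  apply/seteqP; split => [x Ux|x [p _]]; last first.
    by rewrite /F; case: asboolP => // pU /pU.
  have /nbhs_ballP[e /= e0 xeU] : nbhs x U by exact: open_nbhs_nbhs.
  have [k ke] : exists k : nat, k.+1%:R^-1 < e / 2.
    have [k _ /(_ k (leqnn k))] :=
      near_infty_natSinv_lt (PosNum (divr_gt0 e0 (ltr0n R 2))).
    by exists k.
  have k0 : 0 < k.+1%:R^-1 :> R by rewrite invr_gt0 ltr0n.
  have qP i : {q : rat | ratr q \in `](x ord0 i - k.+1%:R^-1), (x ord0 i + k.+1%:R^-1)[}.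
    by apply/cid/rat_in_itvoo; rewrite ltrBlDr -addrA ltrDl addr_gt0.
  pose q : 'rV[rat]_n := \row_i sval (qP i).
  have qx i : `|ratr (q ord0 i) - x ord0 i| < k.+1%:R^-1.
    rewrite mxE; case: (qP i) => r /=.
    by rewrite in_itv /= ltr_distl.
  have boxE y : box (q, k) y <-> forall i, `|y ord0 i - ratr (q ord0 i)| < k.+1%:R^-1.
    by split => h i; have := h i; rewrite /= in_itv/= ltr_distl.
  exists (q, k) => //; rewrite /F; case: asboolP => [_|].
    by apply/boxE => i; rewrite distrC.
  case=> y /boxE yq; apply: xeU; split => // i j; have -> : i = ord0 by exact: ord1.
  rewrite -ball_normE /=; exact: (dist_split (qx j) (yq j)).
apply: countable_bigcupT_measurable; first exact: countableP.
move=> p; rewrite /F; case: asboolP => // _.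
apply: (@measurable_box (fun i =>
  `]ratr (p.1 ord0 i) - p.2.+1%:R^-1, ratr (p.1 ord0 i) + p.2.+1%:R^-1[%classic)) => i.
exact: measurable_itv.
Qed.

Lemma continuous_measurable_rV phi : continuous phi -> measurable_fun setT phi.
Proof.
move=> cphi; apply: (measurability _ (RGenOInfty.measurableE R)).
move=> _ [_ [a ->] <-]; rewrite setTI; apply: open_measurable_rV.
by move/continuousP : cphi; apply; exact: interval_open.
Qed.

Lemma bounded_coord Omega : bounded_set Omega ->
  exists M : R, 0 < M /\ forall x, Omega x -> forall i, `|x ord0 i| <= M.
Proof.
move=> [M [Mr h]]; exists (`|M| + 1); split; first by rewrite ltr_wpDl.
move=> x Ox i; have := h (`|M| + 1) _ x Ox.
rewrite (le_lt_trans (ler_norm M)) ?ltrDl// => /(_ isT); apply: le_trans.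
rewrite [leRHS]/Num.Def.normr/= mx_normrE.
by apply: (le_bigmax _ (fun ij => `|x ij.1 ij.2|) (ord0, i)).
Qed.

Lemma lebesgue_rV_bounded Omega : open Omega -> bounded_set Omega ->
  (lebesgue_rV R n Omega < +oo)%E.
Proof.
move=> oO /bounded_coord[M [M0 OM]].
pose a : 'rV[R]_n := const_mx (- M); pose b : 'rV[R]_n := const_mx M.
pose B := [set x : 'rV[R]_n | forall i, a ord0 i <= x ord0 i <= b ord0 i].
apply: (@le_lt_trans _ _ (lebesgue_rV R n B)).
  apply: le_measure; rewrite ?inE.
  - exact: open_measurable_rV.
  - rewrite (_ : B = [set x | forall i, `[a ord0 i, b ord0 i]%classic (x ord0 i)]).
      apply: (@measurable_box (fun i => `[a ord0 i, b ord0 i]%classic)) => i.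
      exact: measurable_itv.
    by apply/seteqP; split => x h i; have := h i; rewrite /= in_itv.
  - by move=> x Ox i; rewrite !mxE -ler_norml OM.
rewrite lebesgue_rV_box ?ltry// => i; rewrite !mxE.
by rewrite (le_trans _ (ltW M0))// oppr_le0 ltW.
Qed.

Lemma continuous_L2 Omega phi : open Omega -> bounded_set Omega ->
  continuous phi -> L2 (lebesgue_rV R n) Omega phi.
Proof.
move=> oO bO cphi; have mO := open_measurable_rV oO.
have mphi := continuous_measurable_rV cphi.
apply: Lfun2_sqr.
  by apply/(measurable_restrictT phi mO); exact: measurable_funTS.
have -> : (fun x => (phi \_ Omega) x ^+ 2) = (fun x => phi x ^+ 2) \_ Omega.
  by apply/funext => x; rewrite !patchE; case: ifP => //; rewrite expr0n.
rewrite (_ : EFin \o _ = (EFin \o (fun x => phi x ^+ 2)) \_ Omega); last first.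
  by rewrite restrict_EFin.
apply/(integrable_mkcond (EFin \o (fun x => phi x ^+ 2)) mO).
apply: measurable_bounded_integrable => //.
- exact: lebesgue_rV_bounded.
- by apply: measurable_funX; exact: measurable_funTS.
have [M [M0 OM]] := bounded_coord bO.
have cK : compact [set v : 'rV[R]_n | forall i, `[- M, M]%classic (v ord0 i)].
  by apply: (@rV_compact _ _ (fun=> `[- M, M]%classic)) => _; exact: segment_compact.
have /compact_bounded[N [Nr hN]] := continuous_compact (continuous_subspaceT cphi) cK.
exists ((`|N| + 1) ^+ 2); split; first exact: num_real.
move=> x Nx y Oy; rewrite /= normrX (le_trans _ (ltW Nx))//.
rewrite lerXn2r ?nnegrE ?addr_ge0//; apply: hN.
  by rewrite (le_lt_trans (ler_norm N)) ?ltrDl.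
by exists y => // i; rewrite /= in_itv/= -ler_norml; exact: OM.
Qed.

End borel_rV.

(** * Sobolev forms and Schur's product theorem *)

Section sobolev_forms.
Context (R : realType) (n : nat) (Omega : set 'rV[R]_n) (s : R).
Local Notation mu := (lebesgue_rV R n).
Local Notation theta := (frac_part s).
Local Notation slob := (slobodeckij_quotient theta).

Lemma sob_L2 (u : sobolev Omega s) : L2 mu Omega u.
Proof.
apply: sob_der_L2; rewrite /mi_order big1// => i _.
by rewrite ffunE.
Qed.

(** The Sobolev form is a sum of L^2 forms of components, so that facts on Gram
    matrices pass to it one component at a time. *)
Lemma sob_inner_weighted (I J : Type) (r : seq I) (t : seq J) (M : I -> J -> R)
    (u : I -> sobolev Omega s) (v : J -> sobolev Omega s) :
  \sum_(p <- r) \sum_(q <- t) M p q * sob_inner (u p) (v q) =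
  \sum_(a : multiindex n (int_part s) | (mi_order a <= int_part s)%N)
     \sum_(p <- r) \sum_(q <- t)
       M p q * l2inner mu Omega (sob_der (u p) a) (sob_der (v q) a) +
  (if theta == 0 then 0 else
   \sum_(a : multiindex n (int_part s) | mi_order a == int_part s)
     \sum_(p <- r) \sum_(q <- t) M p q *
       l2inner (mu \x mu)%E (Omega `*` Omega)
         (slob (sob_der (u p) a)) (slob (sob_der (v q) a))).
Proof.
have exch (P : pred (multiindex n (int_part s))) F :
    \sum_(p <- r) \sum_(q <- t) M p q * \sum_(a | P a) F p q a =
    \sum_(a | P a) \sum_(p <- r) \sum_(q <- t) M p q * F p q a.
  rewrite [RHS]exchange_big; apply: eq_bigr => p _.
  by rewrite exchange_big; apply: eq_bigr => q _; rewrite mulr_sumr.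
rewrite -exch; case: ifPn => th0; last rewrite -exch -big_split.
  rewrite addr0; apply: eq_bigr => p _; apply: eq_bigr => q _.
  by rewrite /sob_inner th0 addr0.
apply: eq_bigr => p _; rewrite -big_split; apply: eq_bigr => q _.
by rewrite /sob_inner (negbTE th0) mulrDr.
Qed.

Lemma sob_inner_ge0 (u : sobolev Omega s) : 0 <= sob_inner u u.
Proof.
rewrite addr_ge0//; first by apply: sumr_ge0 => a _; exact: l2inner_ge0.
by case: ifP => // _; apply: sumr_ge0 => a _; exact: l2inner_ge0.
Qed.

Lemma schur_sob_inner (I : Type) (r : seq I) (M : I -> I -> R)
    (u : I -> sobolev Omega s) : psd r M ->
  0 <= \sum_(p <- r) \sum_(q <- r) M p q * sob_inner (u p) (u q).
Proof.
move=> M0; rewrite sob_inner_weighted addr_ge0//.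
  apply: sumr_ge0 => a ka; apply: schur_l2inner => // i; exact: sob_der_L2.
case: ifPn => // th0; apply: sumr_ge0 => a /eqP ka.
by apply: schur_l2inner => // i; exact: sob_der_slobodeckij.
Qed.

Lemma mderive_continuous (k : nat) (a : multiindex n k) (phi : 'rV[R]_n -> R) :
  smooth phi -> continuous (mderive a phi).
Proof.
move=> sphi; have [+ _] := sphi (flatten [seq nseq (a i) i | i <- enum 'I_n]).
rewrite /mderive; suff -> : foldr (@partial R n) phi
    (flatten [seq nseq (a i) i | i <- enum 'I_n]) =
  foldr (fun i => iter (a i) (@partial R n i)) phi (enum 'I_n) by [].
elim: (enum 'I_n) => //= i l IH; rewrite foldr_cat IH.
by elim: (nat_of_ord (a i)) => //= m ->.
Qed.

(** Testing against derivatives of a test function is a bounded operation on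
    L^2 of a bounded domain, so that weak derivatives are linear. *)
Lemma sobolev_lin (I : Type) (r : seq I) (w : I -> R) (u : I -> sobolev Omega s) :
  open Omega -> bounded_set Omega ->
  exists v : sobolev Omega s,
    forall a, sob_der v a = fun x => \sum_(i <- r) w i * sob_der (u i) a x.
Proof.
move=> oO bO.
have vL2 a : (mi_order a <= int_part s)%N ->
    L2 mu Omega (fun x => \sum_(i <- r) w i * sob_der (u i) a x).
  by move=> ka; apply: L2_sum => i; exact: sob_der_L2.
have vweak a : (mi_order a <= int_part s)%N ->
    weak_derivative Omega a (fun x => \sum_(i <- r) w i * sob_der (u i) [ffun=> ord0] x)
      (fun x => \sum_(i <- r) w i * sob_der (u i) a x).
  move=> ka phi tphi; rewrite !l2inner_suml.
  - rewrite mulr_sumr; apply: eq_bigr => i _.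
    by rewrite (sob_der_weak (u i) ka tphi) mulrCA.
  - by move=> i; exact: sob_der_L2.
  - by case: tphi => /(_ [::])[? _] _; exact: continuous_L2.
  - by move=> i; exact: sob_L2.
  - by apply: continuous_L2 => //; apply: mderive_continuous; case: tphi.
have vslob : theta != 0 -> forall a, mi_order a = int_part s ->
    L2 (mu \x mu)%E (Omega `*` Omega)
      (slob (fun x => \sum_(i <- r) w i * sob_der (u i) a x)).
  move=> th0 a ka.
  have -> : slob (fun x => \sum_(i <- r) w i * sob_der (u i) a x) =
      fun z => \sum_(i <- r) w i * slob (sob_der (u i) a) z.
    apply/funext => z; rewrite /slobodeckij_quotient -sumrB mulr_suml.
    by apply: eq_bigr => i _; rewrite -mulrBr mulrA.
  by apply: L2_sum => i; exact: sob_der_slobodeckij.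
by exists (Sobolev vL2 vweak vslob).
Qed.

Lemma sob_inner_sum2 (I : Type) (r : seq I) (w : I -> R) (u : I -> sobolev Omega s)
    (v : sobolev Omega s) :
  (forall a, sob_der v a = fun x => \sum_(i <- r) w i * sob_der (u i) a x) ->
  sob_inner v v = \sum_(p <- r) \sum_(q <- r) w p * w q * sob_inner (u p) (u q).
Proof.
move=> vE; rewrite sob_inner_weighted; congr (_ + _).
  by apply: eq_bigr => a ka; rewrite vE l2inner_sum2// => i; exact: sob_der_L2.
case: ifPn => // th0; apply: eq_bigr => a /eqP ka.
have -> : slob (sob_der v a) = fun z => \sum_(i <- r) w i * slob (sob_der (u i) a) z.
  apply/funext => z; rewrite vE /slobodeckij_quotient -sumrB mulr_suml.
  by apply: eq_bigr => i _; rewrite -mulrBr mulrA.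
by rewrite l2inner_sum2// => i; exact: sob_der_slobodeckij.
Qed.

Lemma l2inner_le_sob_inner (u : sobolev Omega s) :
  l2inner mu Omega u u <= sob_inner u u.
Proof.
rewrite /sob_inner (bigD1 [ffun=> ord0])/=; last first.
  by rewrite /mi_order big1// => i _; rewrite ffunE.
rewrite -addrA lerDl addr_ge0//; first by apply: sumr_ge0 => a _; exact: l2inner_ge0.
by case: ifP => // _; apply: sumr_ge0 => a _; exact: l2inner_ge0.
Qed.

End sobolev_forms.

(** Schur's theorem in each factor: if [a p] and [b p] are images of [u p] and
    [v p] under operators of norms at most [c1] and [c2], then the tensor product of the
    operators has norm at most [c1 * c2] for the cross norm. *)
Lemma tensor_operator_bound (R : realType) (n1 n2 : nat)
    (Omega1 : set 'rV[R]_n1) (Omega2 : set 'rV[R]_n2) (s1 s2 : R)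
    (I : Type) (r : seq I) (u : I -> sobolev Omega1 s1) (v : I -> sobolev Omega2 s2)
    (a : I -> 'rV[R]_n1 -> R) (b : I -> 'rV[R]_n2 -> R) (c1 c2 : R) :
  let mu1 := lebesgue_rV R n1 in let mu2 := lebesgue_rV R n2 in
  let F := fun x => \sum_(p <- r) a p x.1 * b p x.2 in
  (forall p, L2 mu1 Omega1 (a p)) -> (forall p, L2 mu2 Omega2 (b p)) ->
  psd r (fun p q => c1 ^+ 2 * sob_inner (u p) (u q) - l2inner mu1 Omega1 (a p) (a q)) ->
  psd r (fun p q => c2 ^+ 2 * sob_inner (v p) (v q) - l2inner mu2 Omega2 (b p) (b q)) ->
  l2inner (mu1 \x mu2)%E (Omega1 `*` Omega2) F F <=
  (c1 * c2) ^+ 2 *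
    \sum_(p <- r) \sum_(q <- r) sob_inner (u p) (u q) * sob_inner (v p) (v q).
Proof.
move=> mu1 mu2 F aL bL psd1 psd2.
have [_ ->] := l2inner_tensor r aL bL.
have := schur_l2inner psd1 bL; have := schur_sob_inner u psd2.
move=> /(mulr_ge0 (sqr_ge0 c1)) h2 h1.
rewrite -subr_ge0; move: (addr_ge0 h1 h2); congr (0 <= _).
rewrite !mulr_sumr -big_split -sumrB /=; apply: eq_bigr => p _.
rewrite !mulr_sumr -big_split -sumrB /=; apply: eq_bigr => q _; ring.
Qed.

(** * Orthogonal projection onto the span of a finite family *)

Section projection.
Context d (T : measurableType d) (R : realType).
Variables (mu : {measure set T -> \bar R}) (D : set T).

Lemma L2_ae_eq (f g : T -> R) : L2 mu D f -> L2 mu D g ->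
  f = g %[ae mu in D] -> l2norm mu D f = l2norm mu D g.
Proof.
move=> fL gL fg; rewrite /l2norm !l2innerE; congr (Num.sqrt (fine _)).
apply: ae_eq_integral => //.
- exact: (measurable_int mu (L2_mul_integrable fL fL)).
- exact: (measurable_int mu (L2_mul_integrable gL gL)).
apply: filterS fg => x fgx _; rewrite /= !patchE; case: ifPn => // /set_mem xD.
by rewrite fgx.
Qed.

Lemma l2inner_eq0 (f : T -> R) : L2 mu D f -> l2inner mu D f f = 0 ->
  f = cst 0 %[ae mu in D].
Proof.
move=> fL f0; have fi := L2_mul_integrable fL fL.
set h := (fun x => f x * f x) \_ D in fi.
have : (\int[mu]_x `|(EFin \o h) x| = 0)%E.
  have -> : (\int[mu]_x `|(EFin \o h) x| = \int[mu]_x (h x)%:E)%E.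
    apply: eq_integral => x _; rewrite /= ger0_norm// /h patchE.
    by case: ifP => // _; rewrite -expr2 sqr_ge0.
  have := integrable_fin_num measurableT fi => /fineK <-.
  by move: f0; rewrite l2innerE /Rintegral => ->.
move/ae_eq_integral_abs => /(_ measurableT (measurable_int _ fi)).
apply: filterS => x /(_ I) + xD; rewrite /= /h patchE mem_set// => -[] /eqP.
by rewrite mulf_eq0 orbb => /eqP.
Qed.

(** When [bt] is biorthogonal to [b] this is [u] minus its projection onto the
    span of [b]; keeping both families explicit makes the rank visible. *)
Definition residual (N : nat) (b bt : 'I_N -> T -> R) (u : T -> R) : T -> R :=
  fun x => u x - \sum_(i < N) l2inner mu D u (bt i) * b i x.

Lemma residual_L2 N (b bt : 'I_N -> T -> R) u :
  (forall i, L2 mu D (b i)) -> L2 mu D u -> L2 mu D (residual b bt u).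
Proof.
by move=> bL uL; apply: L2B => //; exact: L2_sum.
Qed.

Lemma residual_sum N (b bt : 'I_N -> T -> R) (I : Type) (r : seq I) (w : I -> R)
    (u : I -> T -> R) :
  (forall i, L2 mu D (bt i)) -> (forall p, L2 mu D (u p)) ->
  residual b bt (fun x => \sum_(p <- r) w p * u p x) =
  fun x => \sum_(p <- r) w p * residual b bt (u p) x.
Proof.
move=> btL uL; apply/funext => x; rewrite /residual.
under [RHS]eq_bigr do rewrite mulrBr mulr_sumr.
rewrite sumrB exchange_big /=; congr (_ - _); apply: eq_bigr => i _.
by rewrite l2inner_suml// mulr_suml; apply: eq_bigr => p _; rewrite mulrA.
Qed.

(** The dual family comes from the inverse Gram matrix, which exists because a
    vector in its kernel gives a combination of the [b i] of zero norm, which has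
    zero coefficients by linear independence. *)
Lemma orthogonal_residual N (b : 'I_N -> T -> R) :
  (forall i, L2 mu D (b i)) -> L2free mu D b ->
  exists bt : 'I_N -> T -> R, (forall i, L2 mu D (bt i)) /\
    forall u, L2 mu D u -> forall k, l2inner mu D (residual b bt u) (b k) = 0.
Proof.
move=> bL bfree.
pose G : 'M[R]_N := \matrix_(i, j) l2inner mu D (b i) (b j).
have Gu : G \in unitmx.
  rewrite -row_free_unit; apply: inj_row_free => v vG.
  apply/rowP => i; rewrite mxE; apply: (bfree (fun i => v ord0 i)).
  apply: l2inner_eq0; first exact: L2_sum.
  rewrite l2inner_sum2//.
  have := congr1 (fun A : 'rV[R]_N => (A *m v^T) ord0 ord0) vG.
  rewrite mul0mx !mxE => vGv.
  rewrite -[RHS]vGv exchange_big /=; apply: eq_bigr => j _.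
  rewrite !mxE mulr_suml; apply: eq_bigr => k _.
  by rewrite !mxE mulrAC.
pose bt i := fun x => \sum_(j < N) invmx G j i * b j x.
exists bt; split=> [i|u uL k]; first exact: L2_sum.
rewrite l2innerBl//; last exact: L2_sum.
rewrite l2inner_suml//; apply/eqP; rewrite subr_eq0; apply/eqP.
under eq_bigr do rewrite l2innerC l2inner_suml// mulr_suml.
rewrite exchange_big /=.
have GG j : \sum_(i < N) invmx G j i * G i k = (j == k)%:R.
  by have := congr1 (fun A : 'M[R]_N => A j k) (mulVmx Gu); rewrite !mxE.
transitivity (\sum_(j < N) l2inner mu D u (b j) * (j == k)%:R).
  rewrite (bigD1 k)//= eqxx mulr1 big1 ?addr0// => j /negbTE ->.
  by rewrite mulr0.
apply: eq_bigr => j _; rewrite -GG mulr_sumr; apply: eq_bigr => i _.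
by rewrite mxE l2innerC mulrCA mulrA.
Qed.

(** Pythagoras: [u - v] is the residual plus an element of the span of [b]. *)
Lemma orthogonal_residual_min N (b bt : 'I_N -> T -> R) u v (c : 'I_N -> R) :
  (forall i, L2 mu D (b i)) -> L2 mu D u -> L2 mu D v ->
  (forall k, l2inner mu D (residual b bt u) (b k) = 0) ->
  v = (fun x => \sum_i c i * b i x) %[ae mu in D] ->
  l2norm mu D (residual b bt u) <= l2norm mu D (fun x => u x - v x).
Proof.
move=> bL uL vL orth vE.
pose e i := l2inner mu D u (bt i) - c i.
pose y x := \sum_i e i * b i x.
have rL : L2 mu D (residual b bt u) by exact: residual_L2.
have yL : L2 mu D y by exact: L2_sum.
have -> : l2norm mu D (fun x => u x - v x) =
    l2norm mu D (fun x => 1 * residual b bt u x + 1 * y x).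
  apply: L2_ae_eq.
  - exact: L2B.
  - exact: L2_lin.
  apply: filterS vE => x vE xD; rewrite vE// /residual /y !mul1r.
  under [X in _ = _ + X]eq_bigr do rewrite mulrBl.
  by rewrite sumrB addrA subrK.
rewrite ler_wsqrtr// l2inner_lin// expr1n !mul1r !mulr1.
have -> : l2inner mu D (residual b bt u) y = 0.
  rewrite l2innerC l2inner_suml// big1// => k _.
  by rewrite l2innerC orth mulr0.
by rewrite mulr0 addr0 lerDl l2inner_ge0.
Qed.

End projection.

(** * Projections of prescribed rank on a multiscale *)

Section levels.
Context (R : realType).

(** The finest admissible level has, up to a constant, all the dimension that is
    allowed, so that its accuracy is the corresponding power of [N]. *)
Lemma level_choice (B t : R) (n N : nat) : 1 <= B -> 0 <= t -> (0 < n)%N ->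
  2 * B <= N%:R ->
  exists J : nat, 2 * (B * 2 ^+ (J * n)) <= N%:R /\
    2 `^ (- (J%:R * t)) <= (2 * B * 2 ^+ n) `^ (t / n%:R) * N%:R `^ (- (t / n%:R)).
Proof.
move=> B1 t0 n0 BN.
pose P J := 2 * (B * 2 ^+ (J * n)) <= N%:R.
have P0 : exists J, P J by exists 0%N; rewrite /P mul0n expr0 mulr1.
have Pmax J : P J -> (J <= N)%N.
  move=> PJ; apply: ltnW; rewrite -(ltr_nat R); apply: lt_le_trans PJ.
  have : (J%:R : R) < 2 ^+ (J * n).
    rewrite -natrX ltr_nat; apply: leq_trans (ltn_expl J (ltnSn 1)) _.
    by rewrite leq_pexp2l// leq_pmulr.
  move=> h; apply: (lt_le_trans h).
  have p0 : 0 <= 2 ^+ (J * n) :> R by rewrite exprn_ge0.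
  by nra.
have [J PJ Jmax] := ex_maxnP P0 Pmax.
exists J; split => //.
have : N%:R < 2 * B * 2 ^+ n * 2 ^+ (J * n).
  rewrite ltNge; apply/negP => h.
  have /Jmax : P J.+1 by rewrite /P mulSn exprD !mulrA.
  by rewrite ltnn.
move=> /ltW h.
have N0 : 0 < N%:R :> R by apply: lt_le_trans BN; lra.
have K0 : 0 <= 2 * B * 2 ^+ n by rewrite !mulr_ge0 ?exprn_ge0//; lra.
have tn0 : 0 <= t / n%:R by rewrite divr_ge0.
have := ge0_ler_powR tn0 _ _ h; rewrite !nnegrE => /(_ (ltW N0)).
have p0 : 0 <= 2 ^+ (J * n) :> R by rewrite exprn_ge0.
move=> /(_ (mulr_ge0 K0 p0)); rewrite powRM// -(@powR_mulrn _ _ (J * n))// -powRrM natrM.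
have -> : J%:R * n%:R * (t / n%:R) = J%:R * t.
  by field; rewrite pnatr_eq0 -lt0n.
rewrite !powRN => h'.
rewrite -ler_pdivrMr ?invr_gt0 ?powR_gt0// invrK mulrC.
by rewrite ler_pdivrMr ?powR_gt0.
Qed.

Lemma level_coarse (K t : R) (n N : nat) : (0 < N)%N -> N%:R <= K -> 0 <= t ->
  1 <= K `^ (t / n%:R) * N%:R `^ (- (t / n%:R)).
Proof.
move=> N0 NK t0; have N0' : 0 < N%:R :> R by rewrite ltr0n.
rewrite powRN ler_pdivlMr ?powR_gt0// mul1r.
by apply: ge0_ler_powR; rewrite ?nnegrE ?divr_ge0// (le_trans _ NK).
Qed.

End levels.

Section approximation.
Context (R : realType) (n r : nat) (Omega : set 'rV[R]_n) (s : R).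
Local Notation mu := (lebesgue_rV R n).

Lemma sob_norm_ge0 (u : sobolev Omega s) : 0 <= sob_norm u.
Proof. exact: sqrtr_ge0. Qed.

Lemma sob_norm_sqr (u : sobolev Omega s) : sob_norm u ^+ 2 = sob_inner u u.
Proof. by rewrite sqr_sqrtr// sob_inner_ge0. Qed.

Lemma l2norm_le_sob_norm (u : sobolev Omega s) : l2norm mu Omega u <= sob_norm u.
Proof. by rewrite ler_wsqrtr// l2inner_le_sob_inner. Qed.

(** Half of the rank [N] goes to each factor, hence [2 * dm <= N]. When [N] is too
    small for the coarsest space the empty family is used, for which the residual
    is the function itself. *)
Lemma residual_rate (M : multiscale Omega r) : (0 < n)%N -> 0 < s <= r%:R ->
  exists C : R, 0 < C /\ forall N : nat, (0 < N)%N ->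
    exists (dm : nat) (b bt : 'I_dm -> 'rV[R]_n -> R),
    [/\ (2 * dm <= N)%N, forall i, L2 mu Omega (b i), forall i, L2 mu Omega (bt i) &
      forall u : sobolev Omega s, l2norm mu Omega (residual mu Omega b bt u) <=
        C * N%:R `^ (- (s / n%:R)) * sob_norm u].
Proof.
move=> n0 /andP[s0 sr].
have [C0 C0P] := ms_approximation M (introT andP (conj (ltW s0) sr)).
have [a0 [B0 [_ B0gt dimP]]] := ms_dim_growth M.
(* with B >= 1 the admissible levels J stay below N *)
pose B := B0 + 1; have B1 : 1 <= B by rewrite /B lerDr ltW.
pose K := (2 * B * 2 ^+ n) `^ (s / n%:R); pose C := (1 + `|C0|) * K.
have p1 : 1 <= 2 ^+ n :> R by rewrite exprn_ege1// ler1n.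
have K0 : 0 < K by apply: powR_gt0; rewrite !mulr_gt0//; lra.
exists C; split; first by rewrite mulr_gt0// ltr_wpDr.
move=> N N0; have [BN|NB] := leP (2 * B) N%:R; last first.
  pose b0 (i : 'I_0) : 'rV[R]_n -> R := cst 0.
  exists 0%N, b0, b0; split=> [||[]//|u]; [by []|by case|].
  have -> : residual mu Omega b0 b0 u = u.
    by apply/funext => x; rewrite /residual big_ord0 subr0.
  apply: le_trans (l2norm_le_sob_norm u) _.
  rewrite ler_peMl ?sob_norm_ge0// /C -mulrA.
  have := @level_coarse R (2 * B * 2 ^+ n) s n N N0 _ (ltW s0).
  have h : N%:R <= 2 * B * 2 ^+ n.
    by apply: le_trans (ltW NB) _; rewrite ler_peMr//; lra.
  move=> /(_ h) h1; apply: le_trans h1 _.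
  by rewrite -/K ler_peMl ?mulr_ge0 ?powR_ge0// lerDl.
have [J [JN JK]] := level_choice B1 (ltW s0) n0 BN.
have [b [bL bfree VE]] := ms_V_dim M J.
have [bt [btL orth]] := orthogonal_residual bL bfree.
exists (ms_dim M J), b, bt; split=> // [|u].
  rewrite -(ler_nat R) natrM; apply: le_trans JN; rewrite ler_pM2l//.
  have /andP[_ h] := dimP J; apply: (le_trans h).
  by rewrite ler_pM2r ?exprn_gt0// /B lerDl.
have uL := sob_L2 u.
apply: (@le_trans _ _ (C0 * 2 `^ (- (J%:R * s)) * sob_norm u)).
  apply: le_trans (C0P J u); apply: lb_le_inf.
    exists (l2norm mu Omega ((u : _ -> R) - (fun x => \sum_i (fun=> 0) i * b i x))).
    exists (fun x => \sum_i (fun=> 0) i * b i x) => //.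
    rewrite VE; split; first exact: L2_sum.
    by exists (fun=> 0); apply: filterE.
  move=> _ [v + <-]; rewrite VE => -[vL [c vE]].
  exact: (orthogonal_residual_min bL uL vL (orth _ uL) vE).
rewrite ler_wpM2r ?sob_norm_ge0//.
apply: (@le_trans _ _ (`|C0| * 2 `^ (- (J%:R * s)))).
  by rewrite ler_wpM2r ?powR_ge0// ler_norm.
rewrite /C -mulrA; apply: ler_pM; rewrite ?powR_ge0//.
by rewrite lerDr.
Qed.

(** Linearity turns the bound on single functions into one on quadratic forms. *)
Lemma psd_residual (N : nat) (b bt : 'I_N -> 'rV[R]_n -> R) (c : R)
    (I : Type) (t : seq I) (u : I -> sobolev Omega s) :
  open Omega -> bounded_set Omega -> 0 <= c ->
  (forall i, L2 mu Omega (b i)) -> (forall i, L2 mu Omega (bt i)) ->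
  (forall v : sobolev Omega s,
    l2norm mu Omega (residual mu Omega b bt v) <= c * sob_norm v) ->
  psd t (fun p q => c ^+ 2 * sob_inner (u p) (u q) -
    l2inner mu Omega (residual mu Omega b bt (u p)) (residual mu Omega b bt (u q))).
Proof.
move=> oO bO c0 bL btL bound w.
have [v vE] := sobolev_lin t w u oO bO.
have := bound v; rewrite -(ler_pXn2r (n := 2))// ?nnegrE ?l2norm_ge0 ?mulr_ge0 ?sob_norm_ge0//.
rewrite l2norm_sqr exprMn sob_norm_sqr (sob_inner_sum2 vE).
have -> : residual mu Omega b bt v =
    fun x => \sum_(p <- t) w p * residual mu Omega b bt (u p) x.
  rewrite -residual_sum//; last by move=> p; exact: sob_L2.
  by rewrite /sob_fun vE.
rewrite l2inner_sum2; [|by move=> i; apply: residual_L2 => //; exact: sob_L2..].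
rewrite -subr_ge0; congr (0 <= _); rewrite mulr_sumr -sumrB.
apply: eq_bigr => p _; rewrite mulr_sumr -sumrB; apply: eq_bigr => q _; ring.
Qed.

End approximation.

(** * Functions of finite rank *)

Section separable.
Context d1 d2 (T1 : measurableType d1) (T2 : measurableType d2) (R : realType).
Variables (mu1 : {sigma_finite_measure set T1 -> \bar R})
          (mu2 : {sigma_finite_measure set T2 -> \bar R}).
Variables (D1 : set T1) (D2 : set T2).

Definition separable (N : nat) (F : T1 * T2 -> R) : Prop :=
  exists (g1 : 'I_N -> T1 -> R) (g2 : 'I_N -> T2 -> R),
    [/\ forall i, L2 mu1 D1 (g1 i), forall i, L2 mu2 D2 (g2 i) &
        F = fun x => \sum_(i < N) g1 i x.1 * g2 i x.2].

Lemma separable0 N : separable N (fun=> 0).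
Proof.
exists (fun=> cst 0), (fun=> cst 0); split=> [_|_|]; [exact: L2_cst0..|].
by apply/funext => x; rewrite big1// => i _; rewrite mul0r.
Qed.

Lemma separableD N M F G : separable N F -> separable M G ->
  separable (N + M) (fun x => F x + G x).
Proof.
move=> [g1 [g2 [g1L g2L ->]]] [h1 [h2 [h1L h2L ->]]].
pose j A (g : 'I_N -> A) (h : 'I_M -> A) i :=
  match fintype.split i with inl a => g a | inr a => h a end.
exists (j _ g1 h1), (j _ g2 h2); split.
- by move=> i; rewrite /j; case: fintype.split.
- by move=> i; rewrite /j; case: fintype.split.
apply/funext => x; rewrite big_split_ord /=; congr (_ + _); apply: eq_bigr => i _.
  by rewrite /j -[lshift M i]/(unsplit (inl i)) unsplitK.
by rewrite /j -[rshift N i]/(unsplit (inr i)) unsplitK.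
Qed.

Lemma separableW N M F : (N <= M)%N -> separable N F -> separable M F.
Proof.
move=> NM /separableD /(_ (separable0 (M - N))); rewrite subnKC//.
by congr (separable _ _); apply/funext => x; rewrite addr0.
Qed.

Lemma separable_L2 N F : separable N F -> L2 (mu1 \x mu2)%E (D1 `*` D2) F.
Proof.
move=> [g1 [g2 [g1L g2L ->]]].
by have [] := l2inner_tensor (index_enum 'I_N) g1L g2L.
Qed.

End separable.

(** * Approximation of tensors and of their limits *)

Section tensors.
Context (R : realType) (n1 n2 : nat).
Variables (Omega1 : set 'rV[R]_n1) (Omega2 : set 'rV[R]_n2) (s1 s2 : R).
Local Notation mu1 := (lebesgue_rV R n1).
Local Notation mu2 := (lebesgue_rV R n2).
Local Notation mu := (mu1 \x mu2)%E.
Local Notation Omega := (Omega1 `*` Omega2).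
Implicit Types F G : tensor Omega1 Omega2 s1 s2.

Lemma tensor_innerC F G : tensor_inner F G = tensor_inner G F.
Proof.
have sC n (O : set 'rV[R]_n) s (u v : sobolev O s) : sob_inner u v = sob_inner v u.
  rewrite /sob_inner; congr (_ + _); first by apply: eq_bigr => a _; rewrite l2innerC.
  by case: ifP => // _; apply: eq_bigr => a _; rewrite l2innerC.
rewrite /tensor_inner exchange_big; apply: eq_bigr => p _; apply: eq_bigr => q _.
by rewrite (sC _ _ _ p.1) (sC _ _ _ p.2).
Qed.

(** The cross form is positive by Schur's theorem, the weights telling the two
    tensors apart inside one list. *)
Lemma tensor_inner_plane F G (x y : R) :
  0 <= x ^+ 2 * tensor_inner F F + 2 * (x * y) * tensor_inner F G +
       y ^+ 2 * tensor_inner G G.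
Proof.
pose c (e : bool) := if e then x else y.
pose r := map (pair true) F ++ map (pair false) G.
have psd1 (w : bool * _ -> R) : psd r (fun p q => w p * w q).
  move=> w'; suff -> : \sum_(p <- r) \sum_(q <- r) w' p * w' q * (w p * w q) =
    (\sum_(p <- r) w' p * w p) ^+ 2 by exact: sqr_ge0.
  rewrite expr2 mulr_suml; apply: eq_bigr => p _; rewrite mulr_sumr.
  by apply: eq_bigr => q _; rewrite mulrACA.
have psd2 : psd r (fun p q => c p.1 * c q.1 * sob_inner p.2.1 q.2.1).
  move=> w; have := schur_sob_inner (fun p => p.2.1) (psd1 (fun p => w p * c p.1)).
  congr (0 <= _); apply: eq_bigr => p _; apply: eq_bigr => q _; ring.
have := schur_sob_inner (fun p => p.2.2) psd2; congr (0 <= _).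
have E : forall F G a b, \sum_(p <- map (pair a) F) \sum_(q <- map (pair b) G)
    c p.1 * c q.1 * sob_inner p.2.1 q.2.1 * sob_inner p.2.2 q.2.2 =
    c a * c b * tensor_inner F G.
  move=> F' G' a b; rewrite big_map /tensor_inner mulr_sumr; apply: eq_bigr => p _.
  rewrite big_map mulr_sumr; apply: eq_bigr => q _ /=; ring.
rewrite big_cat /=.
under eq_bigr do rewrite big_cat /=.
under [X in _ + X]eq_bigr do rewrite big_cat /=.
rewrite !big_split /= !E /= (tensor_innerC G F); ring.
Qed.

Lemma tensor_inner_ge0 F : 0 <= tensor_inner F F.
Proof.
by have := tensor_inner_plane F F 1 0; rewrite !(mulr0, mul0r, addr0, expr1n, mul1r, expr0n).
Qed.

(** The reverse triangle inequality makes the norms of a Cauchy sequence of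
    tensors converge. *)
Lemma tensor_norm_dist F G : `|tensor_norm F - tensor_norm G| <= tensor_dist F G.
Proof.
have cs : tensor_inner F G <= tensor_norm F * tensor_norm G.
  by apply: cauchy_schwarz_plane; rewrite ?tensor_inner_ge0//; exact: tensor_inner_plane.
rewrite -sqrtr_sqr ler_wsqrtr// sqrrB !sqr_sqrtr ?tensor_inner_ge0//; lra.
Qed.

Lemma hmix_norm_cvg (f : hmix Omega1 Omega2 s1 s2) :
  tensor_norm (hmix_seq f k) @[k --> \oo] --> hmix_norm f.
Proof.
suff : cvg (tensor_norm (hmix_seq f k) @[k --> \oo]) by [].
apply/cauchy_cvgP/cauchy_ballP => e e0.
have [N fN] := hmix_cauchy f e0.
pose A := (fun k => tensor_norm (hmix_seq f k)) @` [set k | (N <= k)%N].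
exists (A, A); first by split; exists N => // k Nk; exists k.
move=> [_ _] [/= [k Nk <-] [l Nl <-]]; rewrite -ball_normE /=.
exact: le_lt_trans (tensor_norm_dist _ _) (fN k l Nk Nl).
Qed.

Lemma hmix_norm_ge0 (f : hmix Omega1 Omega2 s1 s2) : 0 <= hmix_norm f.
Proof.
rewrite -(cvg_lim _ (@hmix_norm_cvg f))//; apply: limr_ge.
  by apply/cvg_ex; exists (hmix_norm f); exact: hmix_norm_cvg.
by apply: nearW => k; exact: sqrtr_ge0.
Qed.

(** Boolean sum: [1 - (1 - P1) (1 - P2)] equals [P1 + (1 - P1) P2], whose first
    term has rank [N1] and whose second one has rank [N2]. *)
Lemma boolean_sum (N1 N2 : nat) (b1 bt1 : 'I_N1 -> 'rV[R]_n1 -> R)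
    (b2 bt2 : 'I_N2 -> 'rV[R]_n2 -> R) F :
  (forall i, L2 mu1 Omega1 (b1 i)) -> (forall i, L2 mu2 Omega2 (b2 i)) ->
  exists2 G, separable mu1 mu2 Omega1 Omega2 (N1 + N2) G &
    (fun x => tensor_fun F x - G x) =
    fun x => \sum_(p <- F) residual mu1 Omega1 b1 bt1 p.1 x.1 *
                           residual mu2 Omega2 b2 bt2 p.2 x.2.
Proof.
move=> b1L b2L.
pose h1 i y := \sum_(p <- F) l2inner mu1 Omega1 p.1 (bt1 i) * p.2 y.
pose h2 k x := \sum_(p <- F) l2inner mu2 Omega2 p.2 (bt2 k) *
  residual mu1 Omega1 b1 bt1 p.1 x.
exists (fun x => \sum_(i < N1) b1 i x.1 * h1 i x.2 +
                \sum_(k < N2) h2 k x.1 * b2 k x.2).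
  apply: separableD.
    exists b1, h1; split=> // i; apply: L2_sum => p; exact: sob_L2.
  exists h2, b2; split=> // k; apply: L2_sum => p.
  by apply: residual_L2 => //; exact: sob_L2.
apply/funext => x.
have -> : \sum_(i < N1) b1 i x.1 * h1 i x.2 =
    \sum_(p <- F) (p.1 x.1 - residual mu1 Omega1 b1 bt1 p.1 x.1) * p.2 x.2.
  under eq_bigr do rewrite mulr_sumr.
  rewrite exchange_big; apply: eq_bigr => p _.
  rewrite /residual opprB addrC subrK mulr_suml; apply: eq_bigr => i _; ring.
have -> : \sum_(k < N2) h2 k x.1 * b2 k x.2 =
    \sum_(p <- F) residual mu1 Omega1 b1 bt1 p.1 x.1 *
      (p.2 x.2 - residual mu2 Omega2 b2 bt2 p.2 x.2).
  under eq_bigr do rewrite mulr_suml.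
  rewrite exchange_big; apply: eq_bigr => p _.
  rewrite /residual opprB [X in _ * X]addrC subrK mulr_sumr.
  by apply: eq_bigr => k _; ring.
rewrite -big_split -sumrB; apply: eq_bigr => p _ /=; ring.
Qed.

Lemma boolean_sum_bound (N1 N2 : nat) (b1 bt1 : 'I_N1 -> 'rV[R]_n1 -> R)
    (b2 bt2 : 'I_N2 -> 'rV[R]_n2 -> R) (c1 c2 : R) F :
  regular_domain Omega1 -> regular_domain Omega2 -> 0 <= c1 -> 0 <= c2 ->
  (forall i, L2 mu1 Omega1 (b1 i)) -> (forall i, L2 mu1 Omega1 (bt1 i)) ->
  (forall i, L2 mu2 Omega2 (b2 i)) -> (forall i, L2 mu2 Omega2 (bt2 i)) ->
  (forall u : sobolev Omega1 s1,
    l2norm mu1 Omega1 (residual mu1 Omega1 b1 bt1 u) <= c1 * sob_norm u) ->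
  (forall v : sobolev Omega2 s2,
    l2norm mu2 Omega2 (residual mu2 Omega2 b2 bt2 v) <= c2 * sob_norm v) ->
  exists2 G, separable mu1 mu2 Omega1 Omega2 (N1 + N2) G &
    L2 mu Omega (fun x => tensor_fun F x - G x) /\
    l2norm mu Omega (fun x => tensor_fun F x - G x) <= c1 * c2 * tensor_norm F.
Proof.
move=> [_ o1 _ bd1 _] [_ o2 _ bd2 _] c10 c20 b1L bt1L b2L bt2L h1 h2.
have [G sG E] := boolean_sum bt1 bt2 F b1L b2L; exists G => //; rewrite E.
have r1L (p : sobolev Omega1 s1 * sobolev Omega2 s2) :
    L2 mu1 Omega1 (residual mu1 Omega1 b1 bt1 p.1).
  by apply: residual_L2 => //; exact: sob_L2.
have r2L (p : sobolev Omega1 s1 * sobolev Omega2 s2) :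
    L2 mu2 Omega2 (residual mu2 Omega2 b2 bt2 p.2).
  by apply: residual_L2 => //; exact: sob_L2.
split; first by have [] := l2inner_tensor F r1L r2L.
apply: l2norm_le; first by rewrite !mulr_ge0// sqrtr_ge0.
rewrite exprMn sqr_sqrtr ?tensor_inner_ge0//.
exact: (@tensor_operator_bound _ _ _ _ _ _ _ _ F fst snd _ _ _ _ r1L r2L
  (psd_residual F fst o1 bd1 c10 b1L bt1L h1)
  (psd_residual F snd o2 bd2 c20 b2L bt2L h2)).
Qed.

Lemma tensor_fun_L2 F : L2 mu Omega (tensor_fun F).
Proof.
by have [] := l2inner_tensor F (fun p => sob_L2 p.1) (fun p => sob_L2 p.2).
Qed.

(** The identity is the residual of the empty family, with norm one. *)
Lemma tensor_fun_bound F : regular_domain Omega1 -> regular_domain Omega2 ->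
  l2norm mu Omega (tensor_fun F) <= tensor_norm F.
Proof.
move=> reg1 reg2.
pose e n (i : 'I_0) : 'rV[R]_n -> R := cst 0.
have res0 n (O : set 'rV[R]_n) (u : 'rV[R]_n -> R) :
    residual (lebesgue_rV R n) O (e n) (e n) u = u.
  by apply/funext => x; rewrite /residual big_ord0 subr0.
have [||||||||G [g1 [g2 [_ _ ->]]] [_]] :=
    @boolean_sum_bound 0 0 (e n1) (e n1) (e n2) (e n2) 1 1 F reg1 reg2;
  rewrite ?ler01//; try by case.
- by move=> u; rewrite res0 mul1r l2norm_le_sob_norm.
- by move=> u; rewrite res0 mul1r l2norm_le_sob_norm.
rewrite !mul1r; congr (l2norm _ _ _ <= _); apply/funext => x.
by rewrite big_ord0 subr0.
Qed.

Lemma hmix_close (f : hmix Omega1 Omega2 s1 s2) (e : R) : 0 < e ->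
  exists F, l2norm mu Omega (fun x => f x - tensor_fun F x) < e /\
    tensor_norm F < hmix_norm f + e.
Proof.
move=> e0.
have h1 : \forall k \near \oo, l2norm mu Omega
    (fun x => f x - tensor_fun (hmix_seq f k) x) < e.
  by move: (hmix_cvg f) => /cvgr_lt; apply.
have h2 : \forall k \near \oo, tensor_norm (hmix_seq f k) < hmix_norm f + e.
  by move: (@hmix_norm_cvg f) => /cvgr_lt; apply; rewrite ltrDl.
have [k _ hk] := filterI h1 h2.
by exists (hmix_seq f k); exact: (hk k (leqnn k)).
Qed.

(** The approximant is that of an algebraic tensor close to [f]: a positive
    [hmix_norm f] leaves room for replacing [f] by that tensor, and [f] vanishes
    almost everywhere when [hmix_norm f] is zero. *)
Lemma hmix_approx (N : nat) (c : R) (f : hmix Omega1 Omega2 s1 s2) :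
  regular_domain Omega1 -> regular_domain Omega2 -> 0 < c ->
  (forall F, exists2 G, separable mu1 mu2 Omega1 Omega2 N G &
    L2 mu Omega (fun x => tensor_fun F x - G x) /\
    l2norm mu Omega (fun x => tensor_fun F x - G x) <= c * tensor_norm F) ->
  exists2 G, separable mu1 mu2 Omega1 Omega2 N G &
    l2norm mu Omega (fun x => f x - G x) <= 3 * c * hmix_norm f.
Proof.
move=> reg1 reg2 c0 approx.
have fFL F : L2 mu Omega (fun x => f x - tensor_fun F x).
  by apply: L2B; [exact: hmix_L2|exact: tensor_fun_L2].
have [L_eq0|L_neq0] := eqVneq (hmix_norm f) 0.
  exists (fun=> 0); first exact: separable0.
  rewrite L_eq0 mulr0; apply/ler_addgt0Pr => e e0.
  have [F [fF Fe]] := hmix_close f (divr_gt0 e0 (ltr0n R 2)).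
  have F0 : (fun x => tensor_fun F x - 0) = tensor_fun F.
    by apply/funext => x; rewrite subr0.
  have := @l2norm_triangle _ _ _ mu Omega f (tensor_fun F) (fun=> 0) (fFL F).
  rewrite F0 => /(_ (tensor_fun_L2 F)) h; apply: (le_trans h).
  have := tensor_fun_bound F reg1 reg2; lra.
have L1 : 0 < hmix_norm f by rewrite lt_def L_neq0 hmix_norm_ge0.
(* 3 = 1 + 2: distance from f to F below c L, norm of F below 2 L *)
pose e := Num.min (c * hmix_norm f) (hmix_norm f).
have [|F [fF Fe]] := @hmix_close f e; first by rewrite lt_min L1 mulr_gt0.
have [G sG [FGL FG]] := approx F; exists G => //.
apply: le_trans (l2norm_triangle (fFL F) FGL) _.
have : e <= c * hmix_norm f by rewrite ge_min lexx.
have : e <= hmix_norm f by rewrite ge_min lexx orbT.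
have : c * tensor_norm F <= c * (hmix_norm f + e) by rewrite ler_pM2l// ltW.
nra.
Qed.

End tensors.

(** * The approximation rate *)

Theorem corollary4p2 (R : realType) (n1 n2 : nat)
  (hn1 : (0 < n1)%N) (hn2 : (0 < n2)%N)
  (Omega1 : set 'rV[R]_n1) (Omega2 : set 'rV[R]_n2)
  (hOmega1 : regular_domain Omega1) (hOmega2 : regular_domain Omega2)
  (r1 r2 : nat) (M1 : multiscale Omega1 r1) (M2 : multiscale Omega2 r2)
  (s1 s2 sigma : R)
  (hs1 : 0 < s1 <= r1%:R) (hs2 : 0 < s2 <= r2%:R) (hsigma : 0 < sigma) :
  let beta := rate n1 n2 s1 s2 sigma in
  beta = (n1%:R * n2%:R)^-1 *
         Num.min (s1 * n1%:R / sigma ^+ 2 + s1 * n2%:R)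
                 (s2 * n1%:R + s2 * n2%:R * sigma ^+ 2) /\
  exists C : R, 0 < C /\
    forall (f : hmix Omega1 Omega2 s1 s2) (N : nat),
      (1 <= N)%N -> (s1 / sigma = s2 * sigma -> (2 <= N)%N) ->
      exists (g1 : 'I_N -> 'rV[R]_n1 -> R) (g2 : 'I_N -> 'rV[R]_n2 -> R),
        let fN := fun x => \sum_(i < N) g1 i x.1 * g2 i x.2 in
        let mu := (lebesgue_rV R n1 \x lebesgue_rV R n2)%E in
        [/\ (forall i, L2 (lebesgue_rV R n1) Omega1 (g1 i)),
            (forall i, L2 (lebesgue_rV R n2) Omega2 (g2 i)),
            L2 mu (Omega1 `*` Omega2) fN,
            (s1 / sigma != s2 * sigma ->
              l2norm mu (Omega1 `*` Omega2) (fun x => f x - fN x)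
                <= C * N%:R `^ (- beta) * hmix_norm f) &
            (s1 / sigma = s2 * sigma ->
              l2norm mu (Omega1 `*` Omega2) (fun x => f x - fN x)
                <= C * N%:R `^ (- beta) * Num.sqrt (ln N%:R) * hmix_norm f)].
Proof.
move=> beta.
have m1 : 0 < n1%:R :> R by rewrite ltr0n.
have m2 : 0 < n2%:R :> R by rewrite ltr0n.
have [s1_gt0 _] := andP hs1; have [s2_gt0 _] := andP hs2.
have betaE : beta = (n1%:R * n2%:R)^-1 *
    Num.min (s1 * n1%:R / sigma ^+ 2 + s1 * n2%:R)
            (s2 * n1%:R + s2 * n2%:R * sigma ^+ 2).
  rewrite /beta /rate mulrAC [_ / (_ * _)]mulrC; congr (_ * _).
  rewrite minr_pMr; last by rewrite addr_ge0 ?divr_ge0 ?mulr_ge0 ?ltW.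
  by congr Num.min; field; rewrite gt_eqF.
split=> //.
(* the sign of s2 * sigma ^+ 2 - s1 decides which argument of the minimum is
   below the rate of the boolean sum *)
have beta_le : beta <= s1 / n1%:R + s2 / n2%:R.
  have E : s1 / n1%:R + s2 / n2%:R = (n1%:R * n2%:R)^-1 * (s1 * n2%:R + s2 * n1%:R).
    by field; rewrite !gt_eqF.
  rewrite betaE E ler_pM2l ?invr_gt0 ?mulr_gt0// ge_min.
  have [s12|/ltW s21] := leP s1 (s2 * sigma ^+ 2); apply/orP; [left|right].
    rewrite addrC lerD2l mulrAC ler_wpM2r ?(ltW m1)//.
    by rewrite ler_pdivrMr// exprn_gt0.
  by rewrite addrC lerD2r mulrAC ler_wpM2r// (ltW m2).
have [C1 [C1_gt0 res1]] := residual_rate M1 hn1 hs1.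
have [C2 [C2_gt0 res2]] := residual_rate M2 hn2 hs2.
pose C0 := 3 * (C1 * C2); have C0_gt0 : 0 < C0 by rewrite !mulr_gt0.
have ln2 : 0 < ln 2 :> R by rewrite ln_gt0// ltr1n.
(* the second term absorbs the logarithmic factor, which is smallest at N = 2 *)
exists (C0 + C0 / Num.sqrt (ln 2)); split.
  by rewrite addr_gt0// divr_gt0// sqrtr_gt0.
move=> f N N_gt0 N2.
have [d1 [b1 [bt1 [d1N b1L bt1L hb1]]]] := res1 N N_gt0.
have [d2 [b2 [bt2 [d2N b2L bt2L hb2]]]] := res2 N N_gt0.
have N1 : 1 <= N%:R :> R by rewrite ler1n.
pose c1 := C1 * N%:R `^ (- (s1 / n1%:R)); pose c2 := C2 * N%:R `^ (- (s2 / n2%:R)).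
have N0 : 0 < N%:R :> R by rewrite ltr0n.
have c1_gt0 : 0 < c1 by rewrite mulr_gt0// powR_gt0.
have c2_gt0 : 0 < c2 by rewrite mulr_gt0// powR_gt0.
have [|G sG fG] := @hmix_approx _ _ _ _ _ _ _ N (c1 * c2) f hOmega1 hOmega2
  (mulr_gt0 c1_gt0 c2_gt0).
  move=> F; have [G sG FG] := boolean_sum_bound F hOmega1 hOmega2 (ltW c1_gt0)
    (ltW c2_gt0) b1L bt1L b2L bt2L hb1 hb2.
  exists G => //; apply: separableW sG.
  by rewrite -(leq_pmul2l (m := 2))// mulnDr (leq_trans (leq_add d1N d2N))// addnn mul2n.
have L0 := hmix_norm_ge0 f.
have bound : l2norm (lebesgue_rV R n1 \x lebesgue_rV R n2)%E (Omega1 `*` Omega2)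
    (fun x => f x - G x) <= C0 * N%:R `^ (- beta) * hmix_norm f.
  apply: (le_trans fG); rewrite ler_wpM2r//.
  have -> : 3 * (c1 * c2) = C0 * N%:R `^ (- (s1 / n1%:R + s2 / n2%:R)).
    by rewrite opprD powRD ?(gt_eqF N0) ?implybT// /c1 /c2 /C0; ring.
  by rewrite ler_pM2l// ler_powR// lerN2.
have GL := separable_L2 sG.
move: sG => [g1 [g2 [g1L g2L GE]]]; exists g1, g2; rewrite -GE; split=> //.
- move=> _; apply: (le_trans bound); rewrite ler_wpM2r// ler_wpM2r ?powR_ge0//.
  by rewrite lerDl divr_ge0// ?sqrtr_ge0// ltW.
- move=> /N2 N_ge2; apply: (le_trans bound); rewrite ler_wpM2r//.
  rewrite [leRHS]mulrAC ler_wpM2r ?powR_ge0//.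
  have lnN : Num.sqrt (ln 2) <= Num.sqrt (ln N%:R) :> R.
    by rewrite ler_wsqrtr// ler_ln ?posrE// ler_nat.
  apply: (@le_trans _ _ (C0 / Num.sqrt (ln 2) * Num.sqrt (ln N%:R))); last first.
    by rewrite ler_wpM2r ?sqrtr_ge0// lerDr ltW.
  rewrite -mulrA ler_peMr ?(ltW C0_gt0)// mulrC ler_pdivlMr ?sqrtr_gt0//.
  by rewrite mul1r.
Qed.
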